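(* Let $n=2$ and $p_1=p_2=1$. Fix $k\in\mathbb{R}^2_{++}$. (i) In the case where $A_1=A_2=A$, $V(w;k)=V_{b^0}(w;k)$ if and only if $w\ge\frac{\rho-A(1-\gamma)}{2\gamma}$. (ii) In the case where $A_1<A_2$, there exist $\overline w>\underline w>0$ such that $V(w;k)=V_{b^0}(w;k)$ for all $w\in[\overline w,+\infty)$, and $V(w;k)\ne V_{b^0}(w;k)$ for all $w\in(0,\underline w)$.
   Context: $\mathbb{R}^2_+$ and $\mathbb{R}^2_{++}$ are the sets of vectors in $\mathbb{R}^2$ with both components $\ge 0$, resp. $>0$. The setting is a growth model on a graph with $n=2$ nodes, with utility weights $p_1,p_2$ (here both equal to $1$). Data: $0<A_1\le A_2$, $\rho>0$, $\gamma>0$ with $\gamma\ne1$, and $\rho>A_2(1-\gamma)$. For a graph weight $w>0$ let $M_w=L+A=\begin{bmatrix}A_1-w&w\\ w&A_2-w\end{bmatrix}$, and let $b^0=b^0(w)\in\mathbb{R}^2_{++}$ be the strictly positive eigenvector (unique up to positive scaling) of $M_w$ associated with its largest eigenvalue $\lambda_0(w)$. For $k\in\mathbb{R}^2$ and $C\in L^1_{\mathrm{loc}}([0,+\infty);\mathbb{R}^2_+)$, $K^{k,C}$ solves $K'(t)=M_wK(t)-C(t)$, $t\ge0$, $K(0)=k$. With $J(C)=\int_0^{+\infty}e^{-\rho t}\sum_{i=1}^2p_i\frac{C_i(t)^{1-\gamma}}{1-\gamma}\,dt$ (integrand $-\infty$ when some $C_i(t)=0$ and $\gamma>1$), define $V(w;k)=\sup\{J(C):C\in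 L^1_{\mathrm{loc}}([0,+\infty);\mathbb{R}^2_+),\ K^{k,C}(t)\in\mathbb{R}^2_+\ \forall t\ge0\}$ and $V_{b^0}(w;k)=\sup\{J(C):C\in L^1_{\mathrm{loc}}([0,+\infty);\mathbb{R}^2_+),\ \langle K^{k,C}(t),b^0\rangle>0\ \forall t\ge0\}$.
   Formalization: In (i), the implication from V(w;k)=V_{b^0}(w;k) to w ≥ (ρ−A(1−γ))/(2γ) is stated only for k_1≠k_2, since for k_1=k_2 equality holds for every w>0; the converse implication is stated for all k. *)

(* Defs.v *)
From HB Require Import structures.
From mathcomp Require Import all_boot all_order all_algebra.
From mathcomp Require Import all_classical all_reals all_analysis.
Set Implicit Arguments.
Unset Strict Implicit.
Unset Printing Implicit Defensive.
Import Order.TTheory GRing.Theory Num.Theory.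
Import numFieldNormedType.Exports.
Local Open Scope classical_set_scope.
Local Open Scope ring_scope.

Definition nonneg_vec (R : realType) (n : nat) (x : 'cV[R]_n) : Prop :=
  forall i, 0 <= x i 0.

Definition pos_vec (R : realType) (n : nat) (x : 'cV[R]_n) : Prop :=
  forall i, 0 < x i 0.

Definition inner (R : realType) (n : nat) (x y : 'cV[R]_n) : R :=
  \sum_i x i 0 * y i 0.

(* M_w = L + A, with L the Laplacian of the two-node graph of weight w and
   A = diag(A1, A2). *)
Definition growth_mx (R : realType) (A1 A2 w : R) : 'M[R]_2 :=
  \matrix_(i, j) if i == j then (if i == 0 then A1 else A2) - w else w.

Definition largest_eigenvalue (R : realType) (n : nat) (M : 'M[R]_n) (l : R)
    : Prop :=
  eigenvalue M l /\ forall a, eigenvalue M a -> a <= l.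

(* The vector is determined only up to a positive scalar factor. *)
Definition positive_top_eigenvector (R : realType) (n : nat) (M : 'M[R]_n)
    (b : 'cV[R]_n) : Prop :=
  pos_vec b /\ exists2 l, largest_eigenvalue M l & M *m b = l *: b.

(* Representatives of the elements of L^1_loc([0, +oo); R^n_+).  Controls are
   total functions on R, whose values at negative times are irrelevant, and
   local integrability on the half-line closed at 0 means integrability on
   every [0, T]. *)
Definition control (R : realType) (n : nat) (C : R -> 'cV[R]_n) : Prop :=
  (forall t, 0 <= t -> nonneg_vec (C t)) /\
  (forall i T, (@lebesgue_measure R).-integrable `[0, T]
                 (fun t => (C t i 0)%:E)).

(* As C is only locally integrable, K' = M K - C, K(0) = k is understood in the
   Caratheodory sense, i.e. in integrated form. *)
Definition state_trajectory (R : realType) (n : nat) (M : 'M[R]_n)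
    (k : 'cV[R]_n) (C K : R -> 'cV[R]_n) : Prop :=
  forall i,
    {within `[0, +oo[, continuous (fun t => K t i 0)} /\
    forall t, 0 <= t ->
      K t i 0 = k i 0
        + Rintegral (@lebesgue_measure R) `[0, t]
            (fun s => (M *m K s - C s) i 0).

(* The test at 0 is needed because 0 `^ a = 0 in the library for a < 0. *)
Definition utility (R : realType) (gamma c : R) : \bar R :=
  if (c == 0) && (1 < gamma) then -oo%E
  else (c `^ (1 - gamma) / (1 - gamma))%:E.

Definition payoff (R : realType) (n : nat) (p : 'I_n -> R) (rho gamma : R)
    (C : R -> 'cV[R]_n) : \bar R :=
  (\int[lebesgue_measure]_(t in `[0%R, +oo[)
     ((expR (- (rho * t)))%R%:E
      * \sum_i ((p i)%:E * utility gamma (C t i 0%R))))%E.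

(* Supremum of the payoff under the state constraint K(t) \in S for t >= 0. *)
Definition constrained_value (R : realType) (n : nat) (p : 'I_n -> R)
    (rho gamma : R) (M : 'M[R]_n) (S : set 'cV[R]_n) (k : 'cV[R]_n) : \bar R :=
  ereal_sup [set payoff p rho gamma C | C in
    [set C | control C /\
       exists2 K, state_trajectory M k C K & forall t, 0 <= t -> S (K t)]].

Definition value (R : realType) (n : nat) (p : 'I_n -> R) (rho gamma : R)
    (M : 'M[R]_n) (k : 'cV[R]_n) : \bar R :=
  constrained_value p rho gamma M [set x | nonneg_vec x] k.

Definition halfspace_value (R : realType) (n : nat) (p : 'I_n -> R)
    (rho gamma : R) (M : 'M[R]_n) (b k : 'cV[R]_n) : \bar R :=
  constrained_value p rho gamma M [set x | 0 < inner x b] k.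

(* Main.v *)
Require Import Defs.
From HB Require Import structures.
From mathcomp Require Import all_boot all_order all_algebra.
From mathcomp Require Import all_classical all_reals all_analysis.
From mathcomp Require Import measurable_realfun ring lra.
Set Implicit Arguments.
Unset Strict Implicit.
Unset Printing Implicit Defensive.
Import Order.TTheory GRing.Theory Num.Theory.
Import numFieldNormedType.Exports.
Local Open Scope classical_set_scope.
Local Open Scope ring_scope.

(* Since [M b = l b], the number [<K, b>] solves a scalar linear equation, and
   the half-space problem has the explicit optimal control
   [C*_i (t) = c_i exp ((l - theta) t)], where
   [theta = (rho - l (1 - gamma)) / gamma] and [c_i] is proportional to
   [b_i ^ (- 1 / gamma)]: the discounted marginal utility of [C*_i (t)] is a
   multiple of [b_i exp (- l t)], so the tangent inequality for the concave
   utility bounds every payoff by that of [C*].  The same bound holds for the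
   problem constrained to the positive orthant, hence [V = V_b0] as soon as the
   state driven by [C*] stays in the orthant, which is read off the
   eigen-decomposition of that state.  Conversely, if the controls admissible
   for the orthant satisfy a linear inequality that [C*] violates, perturbing
   the multiplier [b_i exp (- l t)] in the direction of that inequality gives
   an upper bound of [V] that is strictly below [V_b0]. *)

Local Notation mu := (@lebesgue_measure _).

(** * Integration *)

(** [f] need not be integrable, because a payoff may be [-oo]; the positive and negative parts are
    compared separately. *)
Lemma le_integral_integrable d (T : measurableType d) (R : realType)
    (mu : {measure set T -> \bar R}) (D : set T) (f h : T -> \bar R) :
  measurable D -> measurable_fun D f -> mu.-integrable D h ->
  (forall x, D x -> (f x <= h x)%E) ->
  (\int[mu]_(x in D) f x <= \int[mu]_(x in D) h x)%E.
Proof.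
move=> mD mf ih fh; have mh := measurable_int _ ih.
rewrite integralE [leRHS]integralE leeB//.
- apply: ge0_le_integral => //; [exact: measurable_funepos..|].
  move=> x Dx; apply: (funepos_le (D := D)); last exact/mem_set.
  by move=> y /set_mem; exact: fh.
- apply: ge0_le_integral => //; [exact: measurable_funeneg..|].
  move=> x Dx; apply: (funeneg_le (D := D)); last exact/mem_set.
  by move=> y /set_mem; exact: fh.
Qed.

Lemma continuous_expRM (R : realType) (a : R) :
  continuous (fun t => expR (a * t)).
Proof.
by move=> t; apply: continuous_comp;
  [exact: mulrl_continuous | exact: continuous_expR].
Qed.

Lemma is_derive_expRM (R : realType) (a t : R) :
  is_derive t 1 (fun t => expR (a * t)) (a * expR (a * t)).
Proof.
have H : is_derive t 1 (fun t => a * t) a.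
  by apply: is_derive_eq; rewrite /GRing.scale/= mulr1.
have := @is_derive1_comp _ expR (fun t => a * t) t _ _ (is_derive_expR (a * t)) H.
by rewrite mulrC.
Qed.

Lemma integral_expRN (R : realType) (a : R) : 0 < a ->
  (\int[lebesgue_measure]_(t in `[0%R, +oo[) (expR (- (a * t)))%:E
   = a^-1%:E)%E.
Proof.
move=> a0.
under eq_integral do rewrite -mulNr.
have der (t : R) :
    is_derive t 1 (fun t => - a^-1 * expR (- a * t)) (expR (- a * t)).
  have := is_derive_expRM (- a) t => ?.
  apply: is_derive_eq; rewrite /GRing.scale/=.
  by rewrite mulrA mulrNN mulVf ?mul1r// gt_eqF.
rewrite (@ge0_continuous_FTC2y _ _ (fun t => - a^-1 * expR (- a * t)) _ 0).
- by rewrite mulr0 expR0 mulr1 -EFinB opprK add0r.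
- by move=> x _; exact: expR_ge0.
- apply: continuous_subspaceT; exact: continuous_expRM.
- rewrite -(mulr0 (- a^-1)); apply: cvgMl_tmp.
  under eq_cvg do rewrite mulNr.
  apply: (@cvg_comp _ _ _ ( *%R a) (fun x => expR (- x)) _ (pinfty_nbhs R)).
    by apply: gt0_cvgMry => //; exact: cvg_id.
  exact: cvgr_expR.
- by move=> x _; have [] := der x.
- apply: cvg_at_right_filter; apply: cvgMl_tmp; exact: continuous_expRM.
- by move=> x _; rewrite derive1E; have [] := der x.
Qed.

Lemma integrable_patch (R : realType) (D : set R) (f : R -> R) :
  measurable D -> 
  mu.-integrable D (EFin \o f) -> mu.-integrable setT (EFin \o (f \_ D)).
Proof.
move=> mD fi.
have := (@integrable_mkcond _ _ _ (@lebesgue_measure R) _ (EFin \o f) mD).1 fi.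
by rewrite restrict_EFin.
Qed.

(* Dirichlet's formula: Fubini on the triangle r <= s. *)
Lemma Rintegral_triangle (R : realType) (T : R) (f h : R -> R) :
  mu.-integrable `[0, T] (EFin \o f) -> mu.-integrable `[0, T] (EFin \o h) ->
  \int[mu]_(s in `[0, T]) (h s * \int[mu]_(r in `[0, s]) f r) =
  \int[mu]_(r in `[0, T]) (f r * \int[mu]_(s in `[r, T]) h s).
Proof.
move=> fi hi.
(* Extended by zero, the two sides become the iterated integrals over the plane of a single function
   [G], supported in the triangle [D]. *)
pose f0 := f \_ `[0, T]; pose h0 := h \_ `[0, T].
have f0i : mu.-integrable setT (EFin \o f0) by exact: integrable_patch.
have h0i : mu.-integrable setT (EFin \o h0) by exact: integrable_patch.
have mf0 : measurable_fun setT f0 by apply/measurable_EFinP; case/integrableP: f0i.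
have mh0 : measurable_fun setT h0 by apply/measurable_EFinP; case/integrableP: h0i.
pose D := [set z : R * R | z.2 <= z.1].
have mD : measurable D.
  by rewrite -[D]setTI; apply: measurable_fun_le.
pose G (z : R * R) : R := \1_D z * (h0 z.1 * f0 z.2).
have mG : measurable_fun setT (EFin \o G).
  apply/measurable_EFinP; apply: measurable_funM; first exact: measurable_indic.
  by apply: measurable_funM; apply: measurableT_comp => //.
have DE s y : \1_D (s, y) = (y <= s)%R%:R :> R.
  by rewrite indicE; congr (_%:R); congr nat_of_bool; apply/idP/idP => [/set_mem//|]; exact: mem_set.
(* By Tonelli, integrability on the plane reduces to the finiteness of the product of the two L^1
   norms. *)
have iP : (mu \x mu)%E.-integrable setT (fun z => (h0 z.1 * f0 z.2)%:E).
  apply/integrable12ltyP.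
    by apply/measurable_EFinP; apply: measurable_funM; exact: measurableT_comp.
  under eq_integral => x _.
    under eq_integral do rewrite /= normrM EFinM.
    rewrite ge0_integralZl//; last first.
      by apply/measurable_EFinP; exact: measurableT_comp.
    over.
  have nf : (\int[mu]_y `|f0 y|%:E)%E \is a fin_num.
    by apply: integrable_fin_num => //; exact: integrable_norm.
  rewrite -(fineK nf) integralZr//; last exact: integrable_norm.
  apply: lte_mul_pinfty; [exact: integral_ge0 | | exact: ltry].
  by apply: integrable_fin_num => //; exact: integrable_norm.
have iG : (mu \x mu)%E.-integrable setT (EFin \o G).
  apply: le_integrable iP => // z _; rewrite lee_fin /G normrM.
  by rewrite ler_piMl// indicE; case: (_ \in _); rewrite ?normr1 ?normr0.
have := Fubini iG => /(congr1 fine).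
have E1 (s : R) : (\int[mu]_y (EFin \o G) (s, y) =
    ((fun s => h s * \int[mu]_(r in `[0, s]) f r) \_ `[0, T] s)%:E)%E.
  rewrite patchE; case: ifPn => sT; last first.
    rewrite integral0_eq// => y _; rewrite /= /G/= /h0 patchE (negbTE sT).
    by rewrite mul0r mulr0.
  move: sT; rewrite inE/= in_itv/= => /andP[s0 sT].
  have fis : mu.-integrable `[0, s] (EFin \o f).
    by apply: integrableS fi => //; apply: subset_itvl; rewrite bnd_simp.
  rewrite Rintegral_mkcond /Rintegral EFinM fineK; last first.
    by apply: integrable_fin_num => //; exact: integrable_patch.
  rewrite -integralZl//; last exact: integrable_patch.
  apply: eq_integral => y _; rewrite -EFinM /= /G /h0 /f0 !patchE DE.
  have -> /= : s \in `[0, T]%classic by rewrite inE/= in_itv/= s0.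
  rewrite !mem_setE/= !in_itv/=; congr EFin.
  case: (leP y s) => ys; last by rewrite andbF mul0r mulr0.
  by rewrite mul1r (le_trans ys sT).
have E2 (r : R) : (\int[mu]_x (EFin \o G) (x, r) =
    ((fun r => f r * \int[mu]_(s in `[r, T]) h s) \_ `[0, T] r)%:E)%E.
  rewrite patchE; case: ifPn => rT; last first.
    rewrite integral0_eq// => y _; rewrite /= /G/= /f0 patchE (negbTE rT).
    by rewrite !mulr0.
  move: rT; rewrite inE/= in_itv/= => /andP[r0 rT].
  have fis : mu.-integrable `[r, T] (EFin \o h).
    by apply: integrableS hi => //; apply: subset_itvr; rewrite bnd_simp.
  rewrite Rintegral_mkcond /Rintegral EFinM fineK; last first.
    by apply: integrable_fin_num => //; exact: integrable_patch.
  rewrite -integralZl//; last exact: integrable_patch.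
  apply: eq_integral => y _; rewrite -EFinM /= /G /h0 /f0 !patchE DE.
  have -> /= : r \in `[0, T]%classic by rewrite inE/= in_itv/= r0.
  rewrite !mem_setE/= !in_itv/=; congr EFin.
  case: (leP r y) => ry; last by rewrite mul0r mulr0.
  by rewrite mul1r mulrC (le_trans r0 ry).
under eq_integral do rewrite E1.
under [in RHS]eq_integral do rewrite E2.
by move=> /= H; rewrite Rintegral_mkcond [RHS]Rintegral_mkcond; exact: H.
Qed.

Lemma continuous_integrable_itv (R : realType) (a b : R) (g : R -> R) :
  {within `[a, b], continuous g} -> mu.-integrable `[a, b] (EFin \o g).
Proof. by apply: continuous_compact_integrable; exact: segment_compact. Qed.

(** A continuous weight is bounded on the compact interval, and a bounded measurable factor
    preserves integrability. *)
Lemma integrable_continuousM (R : realType) (a b : R) (g f : R -> R) :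
  continuous g -> mu.-integrable `[a, b] (EFin \o f) ->
  mu.-integrable `[a, b] (EFin \o (fun t => g t * f t)).
Proof.
move=> cg fi.
have -> : EFin \o (fun t => g t * f t) = ((EFin \o g) \* (EFin \o f))%E by [].
apply: integrableMr => //.
  by apply: measurable_funTS; exact: continuous_measurable_fun.
have : compact (g @` `[a, b]).
  by apply: continuous_compact; [exact: continuous_subspaceT | exact: segment_compact].
move=> /compact_bounded [M [Mr HM]]; exists M; split => // N MN t tab.
by apply: HM MN _ _; exists t.
Qed.

Lemma Rintegral_expRM (R : realType) (a r T : R) : r <= T ->
  \int[mu]_(s in `[r, T]) (a * expR (a * s)) = expR (a * T) - expR (a * r).
Proof.
rewrite le_eqVlt => /predU1P[->|rT].
  by rewrite set_itv1 Rintegral_set1 subrr.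
rewrite /Rintegral (@continuous_FTC2 _ _ (fun t => expR (a * t))) //.
- apply: continuous_subspaceT => t; apply: cvgMl_tmp; exact: continuous_expRM.
- split.
  + by move=> x _; have [] := is_derive_expRM a x.
  + by apply: cvg_at_right_filter; exact: continuous_expRM.
  + by apply: cvg_at_left_filter; exact: continuous_expRM.
- by move=> x _; rewrite derive1E; have [] := is_derive_expRM a x.
Qed.

(** Here [x] is a primitive of a merely integrable function, so the product rule cannot be applied
    pointwise. Dirichlet's formula with [h s = a * expR (a * s)] replaces it, the integral of [h]
    being explicit. *)
Lemma Rintegral_expR_by_parts (R : realType) (a T x0 : R) (x f : R -> R) :
  0 <= T -> mu.-integrable `[0, T] (EFin \o f) ->
  {within `[0, T], continuous x} ->
  (forall t, 0 <= t <= T -> x t = x0 + \int[mu]_(s in `[0, t]) f s) ->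
  \int[mu]_(s in `[0, T]) (expR (a * s) * f s) =
  expR (a * T) * x T - x0 - \int[mu]_(s in `[0, T]) (a * expR (a * s) * x s).
Proof.
move=> T0 fi cx xE.
have ch : continuous (fun s => a * expR (a * s)).
  by move=> t; apply: cvgMl_tmp; exact: continuous_expRM.
have hi : mu.-integrable `[0, T] (EFin \o (fun s => a * expR (a * s))).
  by apply: continuous_integrable_itv; exact: continuous_subspaceT.
have xi := continuous_integrable_itv cx.
have hxi := integrable_continuousM ch xi.
have efi := integrable_continuousM (@continuous_expRM _ a) fi.
have E1 : \int[mu]_(s in `[0, T]) (a * expR (a * s) * \int[mu]_(r in `[0, s]) f r) =
    \int[mu]_(s in `[0, T]) (a * expR (a * s) * x s - a * expR (a * s) * x0).
  by apply: eq_Rintegral => s; rewrite inE/= in_itv/= => /xE ->; ring.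
have E2 : \int[mu]_(r in `[0, T]) (f r * \int[mu]_(s in `[r, T]) (a * expR (a * s))) =
    \int[mu]_(r in `[0, T]) (f r * expR (a * T) - expR (a * r) * f r).
  apply: eq_Rintegral => s; rewrite inE/= in_itv/= => /andP[_ sT].
  by rewrite Rintegral_expRM//; ring.
have := Rintegral_triangle fi hi; rewrite E1 E2.
rewrite RintegralB//; last first.
  apply: continuous_integrable_itv; apply: continuous_subspaceT => t.
  by apply: cvgMr_tmp; exact: ch.
rewrite RintegralZr// Rintegral_expRM// mulr0 expR0.
rewrite RintegralB//; last first.
  have := integrable_continuousM (@cst_continuous _ _ (expR (a * T))) fi.
  by apply: eq_integrable => // t _ /=; rewrite mulrC.
rewrite RintegralZr// xE ?T0 ?lexx// => H; lra.
Qed.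

Lemma integrable_sum_EFin d (T : measurableType d) (R : realType)
    (m : {measure set T -> \bar R}) (D : set T) (I : Type) (r : seq I)
    (f : I -> T -> R) :
  measurable D -> (forall i, m.-integrable D (EFin \o f i)) ->
  m.-integrable D (EFin \o (fun t => \sum_(i <- r) f i t)).
Proof.
move=> mD fi.
rewrite (_ : EFin \o _ = fun t => (\sum_(i <- r) (EFin \o f i) t)%E).
  by apply: integrable_sum.
by apply/funext => t /=; rewrite sumEFin.
Qed.

Lemma Rintegral_sum d (T : measurableType d) (R : realType)
    (m : {measure set T -> \bar R}) (D : set T) (I : Type) (r : seq I)
    (f : I -> T -> R) :
  measurable D -> (forall i, m.-integrable D (EFin \o f i)) ->
  \int[m]_(t in D) (\sum_(i <- r) f i t) = \sum_(i <- r) \int[m]_(t in D) f i t.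
Proof.
move=> mD fi; elim: r => [|i r IH].
  by rewrite big_nil; under eq_Rintegral do rewrite big_nil; rewrite Rintegral_cst// mul0r.
rewrite big_cons -IH -RintegralD//; last exact: integrable_sum_EFin.
by apply: eq_Rintegral => t _; rewrite big_cons.
Qed.

(** * State trajectories *)

Section inner_theory.
Variables (R : realType) (n : nat).
Implicit Types (x y v : 'cV[R]_n) (a : R).

Lemma innerDl x y v : inner (x + y) v = inner x v + inner y v.
Proof.
by rewrite /inner -big_split; apply: eq_bigr => i _; rewrite !mxE mulrDl.
Qed.

Lemma innerZl a x v : inner (a *: x) v = a * inner x v.
Proof.
by rewrite /inner mulr_sumr; apply: eq_bigr => i _; rewrite !mxE mulrA.
Qed.

Lemma innerBl x y v : inner (x - y) v = inner x v - inner y v.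
Proof. by rewrite -scaleN1r innerDl innerZl mulN1r. Qed.

Lemma innerC x y : inner x y = inner y x.
Proof. by rewrite /inner; apply: eq_bigr => i _; rewrite mulrC. Qed.

Lemma inner_mulmx (M : 'M[R]_n) x v : inner (M *m x) v = inner x (M^T *m v).
Proof.
rewrite /inner; under eq_bigr do rewrite mxE mulr_suml.
rewrite exchange_big; apply: eq_bigr => j _.
by rewrite mxE mulr_sumr; apply: eq_bigr => i _; rewrite mxE; ring.
Qed.

Lemma inner0l x : inner 0 x = 0.
Proof. by rewrite -(scale0r 0) innerZl mul0r. Qed.

Lemma inner_ge0 x y : nonneg_vec x -> nonneg_vec y -> 0 <= inner x y.
Proof. by move=> x0 y0; apply: sumr_ge0 => i _; rewrite mulr_ge0. Qed.

End inner_theory.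

Section trajectory.
Variables (R : realType) (n : nat) (M : 'M[R]_n) (k : 'cV[R]_n).
Variables (C K : R -> 'cV[R]_n).
Hypotheses (hC : control C) (hK : state_trajectory M k C K).

Lemma control_integrable i (T : R) :
  mu.-integrable `[0, T] (EFin \o (fun t => C t i 0)).
Proof. exact: hC.2. Qed.

Lemma state_continuous i (T : R) :
  {within `[0, T], continuous (fun t => K t i 0)}.
Proof.
apply: continuous_subspaceW (hK i).1.
by apply: subset_itvl; rewrite bnd_simp.
Qed.

Lemma inner_state_continuous (v : 'cV[R]_n) (T : R) :
  {within `[0, T], continuous (fun t => inner (K t) v)}.
Proof.
move=> t; rewrite /inner.
apply: cvg_big => // [|i _]; first exact: add_continuous.
apply: cvgMr_tmp; exact: state_continuous.
Qed.

Lemma inner_control_integrable (v : 'cV[R]_n) (T : R) :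
  mu.-integrable `[0, T] (EFin \o (fun t => inner (C t) v)).
Proof.
apply: integrable_sum_EFin => // i.
exact: (integrableZr _ (v i 0) (control_integrable i T)).
Qed.

Lemma drift_integrable i (T : R) :
  mu.-integrable `[0, T] (EFin \o (fun t => (M *m K t - C t) i 0)).
Proof.
have H1 : mu.-integrable `[0, T] (EFin \o (fun t => inner (K t) (row i M)^T)).
  by apply: continuous_integrable_itv; exact: inner_state_continuous.
rewrite (_ : EFin \o _ = (EFin \o (fun t => inner (K t) (row i M)^T)%R)
    \- (EFin \o (fun t => C t i 0)%R))%E.
  by apply: integrableB => //; exact: control_integrable.
apply/funext => t /=; rewrite !mxE /inner -EFinB; congr (_ - _)%:E.
by apply: eq_bigr => j _; rewrite !mxE mulrC.
Qed.

Lemma inner_state (v : 'cV[R]_n) (t : R) : 0 <= t ->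
  inner (K t) v
  = inner k v + \int[mu]_(s in `[0, t]) inner (M *m K s - C s) v.
Proof.
move=> t0; rewrite /inner Rintegral_sum//; last first.
  by move=> i; exact: (integrableZr _ (v i 0) (drift_integrable i t)).
rewrite -big_split; apply: eq_bigr => i _ /=.
rewrite (hK i).2// mulrDl; congr (_ + _).
by rewrite RintegralZr//; exact: drift_integrable.
Qed.

(** Integration by parts for [expR (a * s) * inner (K s) v], with [M] moved onto [v] by
    transposition. Choosing [v] and [a] so that the last integral vanishes or has a sign turns this
    identity into a budget constraint on consumption. *)
Lemma discounted_consumption (v : 'cV[R]_n) (a T : R) : 0 <= T ->
  \int[mu]_(s in `[0, T]) (expR (a * s) * inner (C s) v) =
  inner k v - expR (a * T) * inner (K T) v
  + \int[mu]_(s in `[0, T]) (expR (a * s) * inner (K s) (M^T *m v + a *: v)).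
Proof.
move=> T0.
have iMC : mu.-integrable `[0, T] (EFin \o (fun s => inner (M *m K s - C s) v)).
  apply: integrable_sum_EFin => // i.
  exact: (integrableZr _ (v i 0) (drift_integrable i T)).
have := Rintegral_expR_by_parts a T0 iMC (@inner_state_continuous v T).
move=> /(_ (inner k v)) => H.
have {}H := H (fun t tT => inner_state v (andP tT).1).
have iK w : mu.-integrable `[0, T] (EFin \o (fun s => expR (a * s) * inner (K s) w)).
  apply: integrable_continuousM; first exact: continuous_expRM.
  by apply: continuous_integrable_itv; exact: inner_state_continuous.
have iC : mu.-integrable `[0, T] (EFin \o (fun s => expR (a * s) * inner (C s) v)).
  by apply: integrable_continuousM; [exact: continuous_expRM | exact: inner_control_integrable].
have E1 : \int[mu]_(s in `[0, T]) (expR (a * s) * inner (M *m K s - C s) v) =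
   \int[mu]_(s in `[0, T]) (expR (a * s) * inner (K s) (M^T *m v)) -
   \int[mu]_(s in `[0, T]) (expR (a * s) * inner (C s) v).
  by rewrite -RintegralB//; apply: eq_Rintegral => s _; rewrite innerBl inner_mulmx mulrBr.
have E2 : \int[mu]_(s in `[0, T]) (a * expR (a * s) * inner (K s) v) =
   a * \int[mu]_(s in `[0, T]) (expR (a * s) * inner (K s) v).
  by rewrite -RintegralZl//; apply: eq_Rintegral => s _; rewrite mulrA.
have E3 : \int[mu]_(s in `[0, T]) (expR (a * s) * inner (K s) (M^T *m v + a *: v)) =
   \int[mu]_(s in `[0, T]) (expR (a * s) * inner (K s) (M^T *m v)) +
   a * \int[mu]_(s in `[0, T]) (expR (a * s) * inner (K s) v).
  rewrite -RintegralZl// -RintegralD//; last first.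
    exact: (integrableZl _ a (iK v)).
  apply: eq_Rintegral => s _.
  by rewrite innerC innerDl innerZl innerC (innerC v); ring.
rewrite E3; rewrite E1 E2 in H; lra.
Qed.

Lemma discounted_consumption_eigen (v : 'cV[R]_n) (a T : R) :
  M^T *m v = a *: v -> 0 <= T ->
  \int[mu]_(s in `[0, T]) (expR (- a * s) * inner (C s) v) =
  inner k v - expR (- a * T) * inner (K T) v.
Proof.
move=> Mv T0; rewrite discounted_consumption// Mv scaleNr subrr.
rewrite (_ : Rintegral _ _ _ = \int[mu]_(s in `[0, T]) (cst 0 s)).
  by rewrite Rintegral_cst// mul0r addr0.
by apply: eq_Rintegral => s _; rewrite innerC inner0l mulr0.
Qed.

End trajectory.

(** * The utility function *)

(** With [x = expR u], everything follows from [1 + y <= expR y]. For [0 < s], the bounds at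
    [(1 - s) * u] and [- (s * u)] are combined with weights [s] and [1 - s], which cancels the terms
    linear in [u]. For [s < 0], the bounds at [u] and [s * u] suffice, since division by [s]
    reverses the order. *)
Lemma powR_le_tangent1 (R : realType) (s x : R) : s < 1 -> s != 0 -> 0 < x ->
  x `^ s / s <= s^-1 + (x - 1).
Proof.
move=> s1 s0 x0; rewrite -(lnK x0); set u := ln x.
rewrite /powR gt_eqF ?expR_gt0// expRK.
have [sgt|slt|sE] := ltrgt0P s; last by rewrite sE eqxx in s0.
- rewrite ler_pdivrMr// mulrDl mulVf//.
  have e0 : 0 < expR (s * u) by exact: expR_gt0.
  have -> : expR u = expR (s * u) * expR ((1 - s) * u) by rewrite -expRD; congr expR; ring.
  have h1 := expR_ge1Dx ((1 - s) * u).
  have h2 := expR_ge1Dx (- (s * u)).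
  have h3 : expR (s * u) * expR (- (s * u)) = 1 by rewrite -expRD subrr expR0.
  have h4 : 1 >= expR (s * u) * (1 + - (s * u)) by rewrite -[leRHS]h3 ler_pM2l.
  have h5 : expR (s * u) * expR ((1 - s) * u) >= expR (s * u) * (1 + (1 - s) * u) by rewrite ler_pM2l.
  nra.
- rewrite ler_ndivrMr// mulrDl mulVf//.
  have h1 := expR_ge1Dx (s * u).
  have h2 := expR_ge1Dx u.
  nra.
Qed.

(** By homogeneity this is the tangent inequality at 1 for the ratio [c / d]. *)
Lemma powR_le_tangent (R : realType) (g c d : R) : 0 < g -> g != 1 ->
  0 < c -> 0 < d ->
  c `^ (1 - g) / (1 - g) <= d `^ (1 - g) / (1 - g) + d `^ (- g) * (c - d).
Proof.
move=> g0 g1 c0 d0.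
have dg : d `^ (1 - g) = d * d `^ (- g).
  by rewrite powRD ?(gt_eqF d0) ?implybT// powRr1// ltW.
have h := @powR_le_tangent1 _ (1 - g) (c / d).
rewrite gtrBl subr_eq0 eq_sym divr_gt0// in h.
have {}h := h g0 g1 isT.
have p0 : 0 < d `^ (1 - g) by exact: powR_gt0.
have -> : c `^ (1 - g) / (1 - g) = d `^ (1 - g) * ((c / d) `^ (1 - g) / (1 - g)).
  by rewrite mulrA -powRM ?ltW ?divr_gt0// (mulrC d) divfK// gt_eqF.
apply: (le_trans (ler_wpM2l (ltW p0) h)); rewrite mulrDr lerD2l.
by rewrite dg le_eqVlt; apply/orP; left; apply/eqP; field; rewrite gt_eqF.
Qed.

Lemma utility_gt0E (R : realType) (g c : R) : 0 < c ->
  utility g c = (c `^ (1 - g) / (1 - g))%:E.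
Proof. by move=> c0; rewrite /utility gt_eqF. Qed.

(** Only [c = 0] is new: the utility is [-oo] there when [1 < g], and when [g < 1] the claim amounts
    to [1 <= (1 - g)^-1]. *)
Lemma utility_le_tangent (R : realType) (g c d : R) : 0 < g -> g != 1 ->
  0 <= c -> 0 < d ->
  (utility g c <= (d `^ (1 - g) / (1 - g) + d `^ (- g) * (c - d))%:E)%E.
Proof.
move=> g0 g1; rewrite le_eqVlt => /predU1P[<-|c0] d0; last first.
  by rewrite utility_gt0E// lee_fin powR_le_tangent.
rewrite /utility eqxx /=; have [?|glt] := ltP 1 g; first by rewrite leNye.
have g1' : g < 1 by rewrite lt_neqAle g1.
rewrite lee_fin powR0 ?mul0r ?subr_eq0 1?eq_sym// sub0r mulrN subr_ge0.
have -> : d `^ (1 - g) = d * d `^ (- g).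
  by rewrite powRD ?(gt_eqF d0) ?implybT// powRr1// ltW.
have p0 : 0 < d * d `^ (- g) by rewrite mulr_gt0// powR_gt0.
by rewrite mulrC ler_pdivlMr ?subr_gt0//; nra.
Qed.

(* Chains the tangent at [q `^ (- g^-1) * d], where the marginal utility is [q]
   times that of [d], with the tangent at [d]. *)
Lemma utility_le_tangent_gain (R : realType) (g c d q Q : R) : 0 < g -> g != 1 ->
  0 <= c -> 0 < d -> 1 <= q <= Q ->
  (utility g c <= (d `^ (1 - g) / (1 - g) + d `^ (- g) * (c - d)
     + (q - 1) * d `^ (- g) * (c - Q `^ (- g^-1) * d))%:E)%E.
Proof.
move=> g0 g1 c0 d0 /andP[q1 qQ].
have q0 : 0 < q by rewrite (lt_le_trans _ q1).
pose e := q `^ (- g^-1) * d.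
have e0 : 0 < e by rewrite mulr_gt0// powR_gt0.
apply: (le_trans (utility_le_tangent g0 g1 c0 e0)); rewrite lee_fin.
have -> : e `^ (- g) = q * d `^ (- g).
  rewrite powRM ?powR_ge0 ?(ltW d0)// -powRrM mulrNN mulVf ?gt_eqF//.
  by rewrite powRr1 ?ltW.
have h := powR_le_tangent g0 g1 e0 d0.
(* Since [q <= Q], replacing [e] by the smaller multiple [X] of [d] only raises the bound, and [X]
   no longer depends on [q]. *)
have eQ : Q `^ (- g^-1) * d <= e.
  rewrite ler_pM2r// !powRN lef_pV2 ?posrE ?powR_gt0//; last first.
    by rewrite (lt_le_trans q0).
  by rewrite ge0_ler_powR// ?nnegrE ?invr_ge0 ?ltW// (lt_le_trans q0).
have p0 : 0 < d `^ (- g) by exact: powR_gt0.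
set X := Q `^ (- g^-1) * d in eQ *.
have : 0 <= (q - 1) * d `^ (- g) * (e - X).
  by rewrite !mulr_ge0 ?subr_ge0 ?(ltW p0).
move=> h2; move: h h2; set D := d `^ (- g); set E := e `^ _; set F := d `^ _.
move=> h h2.
apply: (le_trans (lerD h (lexx _))); nra.
Qed.

Lemma measurable_utility (R : realType) (g : R) :
  measurable_fun setT (utility g).
Proof.
rewrite /utility; apply: measurable_fun_if => //.
- apply: measurable_and; last exact: measurable_cst.
  exact: measurable_fun_eqr.
- apply: measurable_funTS; apply/measurable_EFinP.
  apply: measurable_funM; [exact: measurable_powR|exact: measurable_cst].
Qed.

(** * Integration over the half-line *)

Lemma measurable_fun_halfline (R : realType) (f : R -> R) :
  (forall t : R, measurable_fun (`[0, t] : set R) f) ->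
  measurable_fun (`[0, +oo[ : set R) f.
Proof.
move=> mf; rewrite itv_bndy_bigcup_BRight.
by apply/measurable_fun_bigcup => // i; rewrite add0r; exact: mf.
Qed.

(** Monotone convergence along the intervals [[0, n]]. It carries the budget bound from finite
    horizons to the whole half-line. *)
Lemma ge0_integrable_halfline (R : realType) (f : R -> R) (y : R) :
  (forall t, 0 <= t -> 0 <= f t) ->
  (forall T, mu.-integrable `[0, T] (EFin \o f)) ->
  (forall T, 0 <= T -> \int[mu]_(t in `[0, T]) f t <= y) ->
  mu.-integrable `[0, +oo[ (EFin \o f) /\ \int[mu]_(t in `[0, +oo[) f t <= y.
Proof.
move=> f0 fi fy.
have mf : measurable_fun (`[0, +oo[ : set R) f.
  by apply: measurable_fun_halfline => T; apply/measurable_EFinP; case/integrableP: (fi T).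
have le : (\int[mu]_(t in `[0%R, +oo[) (f t)%:E <= y%:E)%E.
  rewrite itv_bndy_bigcup_BRight.
  pose F (n : nat) : set R := `[0, 0 + n%:R]%classic.
  have cv : (\int[mu]_(t in F n) (EFin \o f) t)%E @[n --> \oo] -->
      (\int[mu]_(t in \bigcup_n F n) (EFin \o f) t)%E.
    apply: ge0_nondecreasing_set_cvg_integral => //.
    - move=> m n mn; rewrite subsetEset; apply: subset_itvl.
      by rewrite bnd_simp !add0r ler_nat.
    - by move=> n; exact: measurable_itv.
    - by move=> n; case/integrableP: (fi (0 + n%:R)).
    - by move=> n t; rewrite /F/= in_itv/= => /andP[/f0].
  apply: cvge_le cv; apply: nearW => n; rewrite /F add0r.
  have nn : 0 <= n%:R :> R by [].
  by have := fy _ nn; rewrite -lee_fin /Rintegral fineK//; exact: integrable_fin_num.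
have nn : (0 <= \int[mu]_(t in `[0%R, +oo[) (f t)%:E)%E.
  by apply: integral_ge0 => t; rewrite /= in_itv/= andbT => /f0.
have nf : (\int[mu]_(t in `[0%R, +oo[) (f t)%:E)%E \is a fin_num.
  by rewrite ge0_fin_numE// (le_lt_trans le) ?ltry.
split; last by rewrite -lee_fin /Rintegral fineK.
apply/integrableP; split; first exact/measurable_EFinP.
apply: le_lt_trans (ltry y); apply: le_trans le.
rewrite le_eqVlt; apply/orP; left; apply/eqP; apply: eq_integral => t.
by rewrite inE/= in_itv/= andbT => /f0 t0; rewrite /= ger0_norm.
Qed.

Lemma integrable_expRN (R : realType) (a : R) : 0 < a ->
  mu.-integrable `[0, +oo[ (EFin \o (fun t => expR (- (a * t)))).
Proof.
move=> a0; apply/integrableP; split.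
  apply/measurable_EFinP; apply: measurable_funTS.
  apply: continuous_measurable_fun; under eq_fun do rewrite -mulNr.
  exact: continuous_expRM.
rewrite (_ : (\int[_]_(_ in _) _)%E = (a^-1)%:E) ?ltry// -integral_expRN//.
by apply: eq_integral => t _; rewrite /= ger0_norm ?expR_ge0.
Qed.

(** * The benchmark control and the Lagrangian bound *)

Section benchmark.
Variables (R : realType) (n : nat) (b : 'cV[R]_n) (l gamma theta y0 : R).
Hypotheses (bpos : pos_vec b) (g0 : 0 < gamma) (g1 : gamma != 1).
Hypotheses (th0 : 0 < theta) (y00 : 0 < y0) (n0 : (0 < n)%N).

Let B := \sum_i b i 0 `^ (1 - gamma^-1).

Let B0 : 0 < B.
Proof.
rewrite /B (bigD1 (Ordinal n0))//= ltr_pwDl ?powR_gt0//.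
by apply: sumr_ge0 => i _; exact: powR_ge0.
Qed.

(** The normalisation is the one for which the coefficients satisfy [\sum_i c_i b_i = theta * y0];
    then [<K, b>] equals [y0] at time 0 and grows at the rate [l - theta]. *)
Definition benchmark_scale := theta * y0 / B.

Definition benchmark_coef i := benchmark_scale * b i 0 `^ (- gamma^-1).

(** The Lagrange multiplier of the budget constraint: the initial marginal utility at node [i] is
    this price times [b_i]. *)
Definition benchmark_price := benchmark_scale `^ (- gamma).

Definition benchmark_control (t : R) : 'cV[R]_n :=
  \col_i (benchmark_coef i * expR ((l - theta) * t)).

Definition benchmark_payoff :=
  theta^-1 * \sum_i (benchmark_coef i `^ (1 - gamma) / (1 - gamma)).

Lemma benchmark_scale_gt0 : 0 < benchmark_scale.
Proof. by rewrite divr_gt0 ?mulr_gt0. Qed.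

Lemma benchmark_price_gt0 : 0 < benchmark_price.
Proof. by rewrite powR_gt0 ?benchmark_scale_gt0. Qed.

Lemma benchmark_coef_gt0 i : 0 < benchmark_coef i.
Proof. by rewrite mulr_gt0 ?benchmark_scale_gt0 ?powR_gt0. Qed.

Lemma benchmark_coefN i :
  benchmark_coef i `^ (- gamma) = benchmark_price * b i 0.
Proof.
rewrite powRM ?powR_ge0 ?ltW ?benchmark_scale_gt0//.
by rewrite -powRrM mulrNN mulVf ?gt_eqF// powRr1 ?ltW.
Qed.

Lemma sum_benchmark_coef : \sum_i benchmark_coef i * b i 0 = theta * y0.
Proof.
rewrite -[RHS](divfK (lt0r_neq0 B0)) mulr_sumr; apply: eq_bigr => i _.
rewrite /benchmark_coef -[LHS]mulrA; congr (_ * _).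
rewrite powRD ?(gt_eqF (bpos i)) ?implybT// mulrC.
by rewrite powRr1// ltW.
Qed.

Lemma benchmark_control_gt0 t i : 0 < benchmark_control t i 0.
Proof. by rewrite mxE mulr_gt0 ?benchmark_coef_gt0 ?expR_gt0. Qed.

Lemma control_benchmark : control benchmark_control.
Proof.
split=> [t _ i|i T]; first by rewrite ltW// benchmark_control_gt0.
apply: continuous_integrable_itv; apply: continuous_subspaceT => t.
rewrite /continuous_at; under eq_cvg do rewrite mxE.
by rewrite mxE; apply: cvgMl_tmp; exact: continuous_expRM.
Qed.

Variables (rho : R) (M : 'M[R]_n) (k : 'cV[R]_n).
Hypothesis rhoE : gamma * theta = rho - l * (1 - gamma).

Local Notation Cb := benchmark_control.

Lemma expR_powR (x a : R) : expR x `^ a = expR (x * a).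
Proof. by rewrite /powR gt_eqF ?expR_gt0// expRK mulrC. Qed.

(** The relation between [theta] and [rho] makes the exponents agree: [- rho + (l - theta) * (1 -
    gamma) = - theta] here, and [- rho - gamma * (l - theta) = - l] for the marginal utility
    below. *)
Lemma discounted_benchmark_power t i :
  expR (- (rho * t)) * Cb t i 0 `^ (1 - gamma) =
  benchmark_coef i `^ (1 - gamma) * expR (- (theta * t)).
Proof.
rewrite mxE powRM ?expR_ge0 ?ltW ?benchmark_coef_gt0// expR_powR.
rewrite mulrCA -expRD; congr (_ * expR _).
by have -> : rho = gamma * theta + l * (1 - gamma) by [rewrite rhoE; ring]; ring.
Qed.

Lemma discounted_benchmark_price t i :
  expR (- (rho * t)) * Cb t i 0 `^ (- gamma) =
  benchmark_price * b i 0 * expR (- (l * t)).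
Proof.
rewrite mxE powRM ?expR_ge0 ?ltW ?benchmark_coef_gt0// expR_powR.
rewrite mulrCA -expRD benchmark_coefN; congr (_ * expR _).
by have -> : rho = gamma * theta + l * (1 - gamma) by [rewrite rhoE; ring]; ring.
Qed.

Lemma payoff_benchmark : payoff (fun=> 1) rho gamma Cb = benchmark_payoff%:E.
Proof.
rewrite /payoff /benchmark_payoff.
under eq_integral => t _.
  under eq_bigr do rewrite mul1e utility_gt0E ?benchmark_control_gt0//.
  rewrite sumEFin -EFinM mulr_sumr.
  under eq_bigr do rewrite mulrA discounted_benchmark_power mulrAC.
  rewrite -mulr_suml mulrC EFinM.
  over.
rewrite integralZr//; last exact: integrable_expRN.
by rewrite integral_expRN// -EFinM.
Qed.

(** This is the Lagrangian bound for the multiplier [b exp (- l t) + eps * phi], up to the price.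
    The pointwise gain inequality is applied with [q] the ratio of this multiplier to the
    unperturbed one, so that [1 + eps * P] bounds [q]. After integration, the unperturbed terms are
    controlled by the budget, and the gain remains. *)
Lemma payoff_le_gain (C K phi : R -> 'cV[R]_n) (T eps P : R) :
  control C -> state_trajectory M k C K -> inner k b = y0 -> M^T *m b = l *: b ->
  (forall t, 0 <= t -> 0 <= inner (K t) b) ->
  0 <= eps -> 0 <= P ->
  (forall i, continuous (fun t => phi t i 0)) ->
  (forall t i, 0 <= t <= T -> 0 <= phi t i 0 <= P * (b i 0 * expR (- (l * t)))) ->
  (payoff (fun=> 1%R) rho gamma C <= (benchmark_payoff + benchmark_price * eps *
     (\int[mu]_(t in `[0, T]) inner (C t) (phi t)
      - (1 + eps * P) `^ (- gamma^-1)
        * \int[mu]_(t in `[0, T]) inner (Cb t) (phi t)))%:E)%E.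
Proof.
move=> hC hK ky Mb Kb eps0 P0 cphi hphi.
set eta := _ `^ _; have p0 := benchmark_price_gt0.
(* Cutting [phi] off outside [[0, T]] gives [q = 1] there, so one pointwise inequality serves all
   times. *)
pose w (t : R) := if 0 <= t <= T then phi t else 0.
pose u i t := benchmark_coef i `^ (1 - gamma) / (1 - gamma) * expR (- (theta * t))
  + benchmark_price * (expR (- (l * t)) * (C t i 0 * b i 0)
       - b i 0 * benchmark_coef i * expR (- (theta * t)))
  + benchmark_price * eps * (C t i 0 * w t i 0 - eta * (Cb t i 0 * w t i 0)).
have pt t : 0 <= t -> ((expR (- (rho * t)))%:E * \sum_i (1%R%:E * utility gamma (C t i 0%R))
    <= (\sum_i u i t)%:E)%E.
  move=> t0.
  pose q i := 1 + eps * (w t i 0 * (b i 0 * expR (- (l * t)))^-1).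
  have w0 i : 0 <= w t i 0 <= P * (b i 0 * expR (- (l * t))).
    rewrite /w; case: ifPn => [/hphi//|_].
    by rewrite mxE lexx !mulr_ge0 ?expR_ge0//; exact/ltW.
  have be i : 0 < b i 0 * expR (- (l * t)) by rewrite mulr_gt0 ?expR_gt0.
  have q1 i : 1 <= q i <= 1 + eps * P.
    have /andP[wi0 wiP] := w0 i.
    rewrite lerDl lerD2l; apply/andP; split; last by rewrite ler_wpM2l// ler_pdivrMr.
    by rewrite mulr_ge0// divr_ge0// ltW.
  have : (\sum_i (1%R%:E * utility gamma (C t i 0%R)) <= (\sum_i
     (Cb t i 0 `^ (1 - gamma) / (1 - gamma) + Cb t i 0 `^ (- gamma) * (C t i 0 - Cb t i 0)
     + (q i - 1) * Cb t i 0 `^ (- gamma) * (C t i 0 - eta * Cb t i 0)))%:E)%E.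
    rewrite -sumEFin; apply: lee_sum => i _; rewrite mul1e.
    by apply: utility_le_tangent_gain; rewrite ?benchmark_control_gt0 ?(hC.1 _ t0).
  have eR : (0 <= (expR (- (rho * t)))%:E)%E by rewrite lee_fin expR_ge0.
  move=> /(lee_wpmul2l eR) /le_trans; apply; rewrite -EFinM lee_fin mulr_sumr.
  rewrite le_eqVlt; apply/orP; left; apply/eqP; apply: eq_bigr => i _.
  have H1 := discounted_benchmark_power t i.
  have H2 := discounted_benchmark_price t i.
  have H3 : (q i - 1) * (b i 0 * expR (- (l * t))) = eps * w t i 0.
    by rewrite addrAC subrr add0r -[LHS]mulrA divfK// gt_eqF.
  have H4 : Cb t i 0 * expR (- (l * t)) = benchmark_coef i * expR (- (theta * t)).
    by rewrite mxE -mulrA -expRD; congr (_ * expR _); ring.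
  set e := expR (- (rho * t)) in H1 H2 *; set Y := _ `^ (- gamma) in H2 *.
  transitivity (e * Cb t i 0 `^ (1 - gamma) / (1 - gamma) + (e * Y) * (C t i 0 - Cb t i 0)
    + (q i - 1) * (e * Y) * (C t i 0 - eta * Cb t i 0)); first by ring.
  rewrite H1 H2 /u (_ : benchmark_price * eps * _ =
    benchmark_price * (eps * w t i 0) * (C t i 0 - eta * Cb t i 0)); last by ring.
  rewrite -H3 -[b i 0 * benchmark_coef i * _]mulrA -H4.
  by ring.
pose Dphi t := inner (C t) (phi t) - eta * inner (Cb t) (phi t).
(* The majorant is regrouped into three separately integrable pieces: a pure exponential, the
   discounted consumption and the truncated gain. *)
pose h (t : R) : R := (\sum_i (benchmark_coef i `^ (1 - gamma) / (1 - gamma))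
    - benchmark_price * (theta * y0)) * expR (- (theta * t))
  + benchmark_price * (expR (- l * t) * inner (C t) b)
  + benchmark_price * eps * (Dphi \_ `[0, T]) t.
have uh t : 0 <= t -> \sum_i u i t = h t.
  move=> t0; rewrite /u !big_split/= /h -sum_benchmark_coef.
  rewrite -[X in X + _ + _]mulr_suml -!mulr_sumr sumrB -mulr_sumr.
  rewrite (_ : \sum_i (C t i 0 * w t i 0 - eta * (Cb t i 0 * w t i 0)) =
      (Dphi \_ `[0, T]) t).
    rewrite (_ : \sum_i (b i 0 * benchmark_coef i * expR (- (theta * t))) =
      (\sum_i benchmark_coef i * b i 0) * expR (- (theta * t))); first by rewrite mulNr /inner; ring.
    by rewrite mulr_suml; apply: eq_bigr => i _; ring.
  rewrite sumrB -mulr_sumr patchE mem_setE/= in_itv/= /w; case: ifPn => // _.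
  by rewrite !big1 ?mulr0 ?subr0// => i _; rewrite [in X in _ * X]mxE mulr0.
have iE := integrable_expRN th0.
have [iX leX] : mu.-integrable `[0, +oo[ (EFin \o (fun t => expR (- l * t) * inner (C t) b))
  /\ \int[mu]_(t in `[0, +oo[) (expR (- l * t) * inner (C t) b) <= y0.
  apply: ge0_integrable_halfline => [t t0|t|t t0].
  - rewrite mulr_ge0 ?expR_ge0//; apply: sumr_ge0 => i _.
    by rewrite mulr_ge0 ?(hC.1 _ t0)// ltW.
  - apply: integrable_continuousM; first exact: continuous_expRM.
    exact: inner_control_integrable.
  - rewrite (discounted_consumption_eigen hC hK Mb t0) ky.
    by rewrite lerBlDr lerDl mulr_ge0 ?expR_ge0 ?Kb.
have iCphi : mu.-integrable `[0, T] (EFin \o (fun t => inner (C t) (phi t))).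
  apply: integrable_sum_EFin => // i.
  have := integrable_continuousM (cphi i) (control_integrable hC i T).
  by apply: eq_integrable => // t _ /=; rewrite mulrC.
have iCbphi : mu.-integrable `[0, T] (EFin \o (fun t => inner (Cb t) (phi t))).
  apply: integrable_sum_EFin => // i.
  have := integrable_continuousM (cphi i) (control_integrable control_benchmark i T).
  by apply: eq_integrable => // t _ /=; rewrite mulrC.
have ieCb : mu.-integrable `[0, T] (EFin \o (fun t => eta * inner (Cb t) (phi t))).
  exact: (integrableZl _ eta iCbphi).
have iD : mu.-integrable `[0, T] (EFin \o Dphi) by exact: (integrableB _ iCphi ieCb).
have setT0 : (`[0, +oo[ `&` `[0, T] : set R) = `[0, T]%classic.
  by apply: setIidr => t /=; rewrite !in_itv/= andbT => /andP[].
have iD0 : mu.-integrable `[0, +oo[ (EFin \o (Dphi \_ `[0, T])).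
  by rewrite -restrict_EFin; apply/integrable_restrict => //; rewrite setT0.
have i1 a : mu.-integrable `[0, +oo[ (EFin \o (fun t => a * expR (- (theta * t)))).
  exact: (integrableZl _ a iE).
have i2 a : mu.-integrable `[0, +oo[ (EFin \o (fun t => a * (expR (- l * t) * inner (C t) b))).
  exact: (integrableZl _ a iX).
have i3 a : mu.-integrable `[0, +oo[ (EFin \o (fun t => a * (Dphi \_ `[0, T]) t)).
  exact: (integrableZl _ a iD0).
have i12 a c : mu.-integrable `[0, +oo[ (EFin \o (fun t => a * expR (- (theta * t)) +
    c * (expR (- l * t) * inner (C t) b))).
  exact: (integrableD _ (i1 a) (i2 c)).
have ih : mu.-integrable `[0, +oo[ (EFin \o h).
  exact: (integrableD _ (i12 _ _) (i3 _)).
apply: (@le_trans _ _ (\int[mu]_(t in `[0%R, +oo[) (h t)%:E)%E).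
  apply: le_integral_integrable => //.
    apply: emeasurable_funM.
      apply/measurable_EFinP; apply: measurable_funTS.
      apply: continuous_measurable_fun; under eq_fun do rewrite -mulNr.
      exact: continuous_expRM.
    apply: emeasurable_sum => i; apply: emeasurable_funM => //.
    apply: measurableT_comp; first exact: measurable_utility.
    apply: measurable_fun_halfline => t; apply/measurable_EFinP.
    by case/integrableP: (control_integrable hC i t).
  by move=> t; rewrite /= in_itv/= andbT => t0; rewrite -uh// pt.
rewrite -[leLHS]fineK; last exact: integrable_fin_num.
rewrite lee_fin -/(Rintegral _ _ _) /h.
rewrite RintegralD// RintegralD// !RintegralZl//.
rewrite -Rintegral_mkcondr setT0 RintegralB// RintegralZl//.
rewrite [\int[mu]_(_ in _) expR (- (theta * _))]/Rintegral integral_expRN//=.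
(* The budget contributes at most [benchmark_price * y0], which cancels the integral of the
   [theta * y0] term of [h]. *)
rewrite lerD2r; apply: (le_trans (lerD (lexx _) (ler_wpM2l (ltW p0) leX))).
rewrite le_eqVlt; apply/orP; left; apply/eqP.
by rewrite /benchmark_payoff; field; rewrite gt_eqF.
Qed.

Hypotheses (ky : inner k b = y0) (Mb : M^T *m b = l *: b).
Variable S : set 'cV[R]_n.
Hypothesis Sb : forall x, S x -> 0 <= inner x b.

(** The Lagrangian bound with no perturbation. *)
Lemma constrained_value_le_benchmark :
  (constrained_value (fun=> 1%R) rho gamma M S k <= benchmark_payoff%:E)%E.
Proof.
apply: ge_ereal_sup => _ [C [hC [K hK SK]] <-].
have Kb t : 0 <= t -> 0 <= inner (K t) b by move=> /SK/Sb.
have := @payoff_le_gain C K (fun=> 0) 0 0 0 hC hK ky Mb Kb (lexx _) (lexx _).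
rewrite mulr0 mul0r addr0; apply=> [i|t i _]; last by rewrite mxE lexx mul0r lexx.
by under eq_fun do rewrite mxE; exact: cst_continuous.
Qed.

Lemma constrained_value_eq_benchmark (K : R -> 'cV[R]_n) :
  state_trajectory M k benchmark_control K -> (forall t, 0 <= t -> S (K t)) ->
  constrained_value (fun=> 1%R) rho gamma M S k = benchmark_payoff%:E.
Proof.
move=> hK SK; apply/eqP; rewrite eq_le constrained_value_le_benchmark/=.
rewrite -payoff_benchmark; apply: ereal_sup_ubound.
by exists benchmark_control => //; split; [exact: control_benchmark | exists K].
Qed.

(* To first order in [eps], adding [eps * phi] to the multiplier
   [b exp (- l t)] changes the Lagrangian bound by a multiple of
   [eps * (Q - \int <C*, phi>)], which is negative. *)
Lemma constrained_value_lt_benchmark (phi : R -> 'cV[R]_n) (T P Q : R) :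
  0 < P -> 0 <= Q ->
  (forall i, continuous (fun t => phi t i 0)) ->
  (forall t i, 0 <= t <= T -> 0 <= phi t i 0 <= P * (b i 0 * expR (- (l * t)))) ->
  (forall C K, control C -> state_trajectory M k C K ->
     (forall t, 0 <= t -> S (K t)) ->
     \int[mu]_(t in `[0, T]) inner (C t) (phi t) <= Q) ->
  Q < \int[mu]_(t in `[0, T]) inner (benchmark_control t) (phi t) ->
  (constrained_value (fun=> 1%R) rho gamma M S k < benchmark_payoff%:E)%E.
Proof.
move=> P0 Q0 cphi hphi hQ; set F := \int[mu]_(_ in _) _ => QF.
have p0 := benchmark_price_gt0.
have F0 : 0 < F by exact: le_lt_trans QF.
pose r := (Q + F) / 2 / F.
have r0 : 0 < r by rewrite !divr_gt0// ltr_wpDl.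
have r1 : r < 1 by rewrite /r ltr_pdivrMr// mul1r ltr_pdivrMr//; lra.
pose eps := (r `^ (- gamma) - 1) / P.
have rg : 1 < r `^ (- gamma).
  rewrite powRN -[ltLHS]invr1 ltf_pV2 ?posrE ?powR_gt0//.
  have := gt0_ltr_powR g0 _ _ r1; rewrite powR1 !nnegrE; apply; exact/ltW.
have eps0 : 0 < eps by rewrite divr_gt0// subr_gt0.
have epsE : (1 + eps * P) `^ (- gamma^-1) = r.
  rewrite /eps divfK ?gt_eqF// addrC subrK -powRrM mulrNN mulfV ?gt_eqF//.
  by rewrite powRr1// ltW.
have rF : r * F = (Q + F) / 2 by rewrite /r divfK// gt_eqF.
apply: (@le_lt_trans _ _ (benchmark_payoff + benchmark_price * eps * (Q - r * F))%:E).
  apply: ge_ereal_sup => _ [C [hC [K hK SK]] <-].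
  have Kb t : 0 <= t -> 0 <= inner (K t) b by move=> /SK/Sb.
  have := payoff_le_gain hC hK ky Mb Kb (ltW eps0) (ltW P0) cphi hphi.
  rewrite epsE => /le_trans; apply; rewrite lee_fin lerD2l.
  by rewrite ler_wpM2l ?lerD2r ?(hQ C K)// mulr_ge0 ?ltW.
rewrite lte_fin gtrDl nmulr_llt0.
  by rewrite mulr_gt0.
by rewrite rF; lra.
Qed.

End benchmark.

(** * Two nodes *)

Lemma state_trajectory_of_is_derive (R : realType) (n : nat) (M : 'M[R]_n)
    (k : 'cV[R]_n) (C K : R -> 'cV[R]_n) :
  K 0 = k -> (forall i, continuous (fun t => C t i 0)) ->
  (forall i (t : R), is_derive t 1 (fun t => K t i 0) ((M *m K t - C t) i 0)) ->
  state_trajectory M k C K.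
Proof.
move=> K0 cC dK i.
have cK j : continuous (fun t => K t j 0).
  by move=> t; apply: differentiable_continuous; apply/derivable1_diffP; have [] := dK j t.
split; first exact: continuous_subspaceT.
move=> t; rewrite le_eqVlt => /predU1P[<-|t0].
  by rewrite set_itv1 Rintegral_set1 addr0 K0.
have cf : continuous (fun t => (M *m K t - C t) i 0).
  move=> s; rewrite /continuous_at; under eq_cvg do rewrite !mxE.
  rewrite !mxE; apply: cvgB; last exact: cC.
  apply: cvg_big => // [|j _]; first exact: add_continuous.
  by apply: cvgMl_tmp; exact: cK.
rewrite /Rintegral (@continuous_FTC2 _ _ (fun t => K t i 0))//.
- by rewrite -EFinB/= K0 addrC subrK.
- exact: continuous_subspaceT.
- split.
  + by move=> x _; have [] := dK i x.
  + by apply: cvg_at_right_filter; exact: cK.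
  + by apply: cvg_at_left_filter; exact: cK.
- by move=> x _; rewrite derive1E; have [] := dK i x.
Qed.

(* [E] is the divided difference of [exp (x t)] between [m] and [g], which
   degenerates to [t exp (m t)] in the resonant case [g = m]. *)
Lemma exponential_response (R : realType) (m g : R) :
  exists E : R -> R, [/\ E 0 = 0,
    forall t : R, is_derive t 1 E (m * E t + expR (g * t)),
    forall t, 0 <= t -> 0 <= E t &
    forall t, expR (g * t) - expR (m * t) = (g - m) * E t].
Proof.
have [->|gm] := eqVneq g m.
  exists (fun t => t * expR (m * t)); split.
  - by rewrite mul0r.
  - move=> t; have dm := is_derive_expRM m t.
    by apply: is_derive_eq; rewrite /GRing.scale/=; ring.
  - by move=> t t0; rewrite mulr_ge0 ?expR_ge0.
  - by move=> t; rewrite !subrr mul0r.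
have gm0 : g - m != 0 by rewrite subr_eq0.
exists (fun t => (g - m)^-1 * (expR (g * t) - expR (m * t))); split.
- by rewrite !mulr0 subrr mulr0.
- move=> t; have dm := is_derive_expRM m t; have dg := is_derive_expRM g t.
  by apply: is_derive_eq; rewrite /GRing.scale/=; field.
- move=> t t0; have [h|h] := leP g m.
    rewrite nmulr_rge0 ?invr_lt0 ?subr_lt0 ?lt_neqAle ?gm//.
    by rewrite subr_le0 ler_expR ler_wpM2r.
  rewrite mulr_ge0 ?invr_ge0 ?subr_ge0 ?(ltW h)// ler_expR.
  by rewrite ler_wpM2r// ltW.
- by move=> t; rewrite mulrA mulfV// mul1r.
Qed.

Lemma ord2P (i : 'I_2) : i = 0 \/ i = 1.
Proof. by case: i => [[|[|//]] p]; [left|right]; exact: val_inj. Qed.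

Lemma sum_ord2 (R : realType) (F : 'I_2 -> R) : \sum_i F i = F 0 + F 1.
Proof.
rewrite !big_ord_recl big_ord0 addr0; congr (_ + F _); exact: val_inj.
Qed.

Lemma inner2E (R : realType) (x y : 'cV[R]_2) :
  inner x y = x 0 0 * y 0 0 + x 1 0 * y 1 0.
Proof. by rewrite /inner sum_ord2. Qed.

Lemma mulmx_growth0 (R : realType) (A1 A2 w : R) (x : 'cV[R]_2) :
  (growth_mx A1 A2 w *m x) 0 0 = (A1 - w) * x 0 0 + w * x 1 0.
Proof. by rewrite mxE sum_ord2 !mxE. Qed.

Lemma mulmx_growth1 (R : realType) (A1 A2 w : R) (x : 'cV[R]_2) :
  (growth_mx A1 A2 w *m x) 1 0 = w * x 0 0 + (A2 - w) * x 1 0.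
Proof. by rewrite mxE sum_ord2 !mxE. Qed.

Lemma tr_growth_mx (R : realType) (A1 A2 w : R) :
  (growth_mx A1 A2 w)^T = growth_mx A1 A2 w.
Proof.
apply/matrixP => i j; rewrite !mxE eq_sym; case: eqP => // ->; by [].
Qed.

Section two_nodes.
Variables (R : realType) (A1 A2 w l gamma theta rho y0 : R) (b k : 'cV[R]_2).
Hypotheses (bpos : pos_vec b) (g0 : 0 < gamma) (g1 : gamma != 1).
Hypotheses (th0 : 0 < theta) (y00 : 0 < y0).
Hypotheses (Mb : growth_mx A1 A2 w *m b = l *: b) (ky : inner k b = y0).
Hypothesis rhoE : gamma * theta = rho - l * (1 - gamma).

Let b1 := b 0 0.
Let b2 := b 1 0.
Let c1 := benchmark_coef b gamma theta y0 0.
Let c2 := benchmark_coef b gamma theta y0 1.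
(** [g] is the growth rate of the benchmark control. As the matrix is symmetric, [(b2, - b1)] is its
    other eigenvector; [m] is the corresponding eigenvalue, read off the trace, and [q] is the
    pairing of the initial consumption with that vector. *)
Let g := l - theta.
Let m := A1 + A2 - 2 * w - l.
Let q := c1 * b2 - c2 * b1.

Lemma eigen_eq0 : (A1 - w) * b1 + w * b2 = l * b1.
Proof. by rewrite -(mulmx_growth0 A1 A2) Mb mxE. Qed.

Lemma eigen_eq1 : w * b1 + (A2 - w) * b2 = l * b2.
Proof. by rewrite -(mulmx_growth1 A1) Mb mxE. Qed.

(** In the orthogonal basis [b], [(b2, - b1)] the state equation decouples. The pairing with [b] is
    [y0 * expR (g * t)], and the pairing [z] with [(b2, - b1)] solves [z' = m z - q exp (g t)],
    whose forced response is [- q * E]. *)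
Lemma benchmark_trajectory : exists E K : _,
  [/\ state_trajectory (growth_mx A1 A2 w) k (benchmark_control b l gamma theta y0) K,
    forall t, 0 <= t -> 0 <= E t,
    forall t, expR (g * t) - expR (m * t) = (g - m) * E t &
    forall t, (b1 ^+ 2 + b2 ^+ 2) * K t 0 0 =
        y0 * b1 * expR (g * t) + b2 * ((k 0 0 * b2 - k 1 0 * b1) * expR (m * t) - q * E t) /\
       (b1 ^+ 2 + b2 ^+ 2) * K t 1 0 =
        y0 * b2 * expR (g * t) - b1 * ((k 0 0 * b2 - k 1 0 * b1) * expR (m * t) - q * E t)].
Proof.
have [E [E0 dE Ege0 Egm]] := exponential_response m g.
have b10 : 0 < b1 := bpos 0; have b20 : 0 < b2 := bpos 1.
pose N := b1 ^+ 2 + b2 ^+ 2.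
have N0 : N != 0 by rewrite gt_eqF// addr_gt0// exprn_gt0.
pose z t := (k 0 0 * b2 - k 1 0 * b1) * expR (m * t) - q * E t.
pose K (t : R) : 'cV[R]_2 := \col_i if i == 0 then N^-1 * (y0 * b1 * expR (g * t) + b2 * z t)
   else N^-1 * (y0 * b2 * expR (g * t) - b1 * z t).
exists E, K; split => //; last first.
  by move=> t; rewrite !mxE/= !mulrA mulfV// !mul1r.
have yE : y0 = k 0 0 * b1 + k 1 0 * b2 by rewrite -ky inner2E.
have cb : c1 * b1 + c2 * b2 = theta * y0.
  by rewrite -(sum_benchmark_coef gamma theta y0 bpos)// sum_ord2.
apply: state_trajectory_of_is_derive.
- apply/matrixP => i j; rewrite ord1 mxE /z E0 !mulr0 expR0 yE.
  by have [->|->] := ord2P i => /=; rewrite /N; field.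
- move=> i t; rewrite /continuous_at; under eq_cvg do rewrite mxE.
  by rewrite mxE; apply: cvgMl_tmp; exact: continuous_expRM.
move=> i t; have dm := is_derive_expRM m t; have dg := is_derive_expRM g t.
have dEt := dE t.
have e1 := eigen_eq0; have e2 := eigen_eq1.
(* [e3] and [e4] say that [(b2, - b1)] is an eigenvector for [m]. *)
have e3 : m * b2 = (A1 - w) * b2 - w * b1.
  by rewrite /m !(mulrBl, mulrDl) -e2; ring.
have e4 : m * b1 = (A2 - w) * b1 - w * b2.
  by rewrite /m !(mulrBl, mulrDl) -e1; ring.
have subE (u v : 'cV[R]_2) j : (u - v) j 0 = u j 0 - v j 0 by rewrite !mxE.
have [->|->] := ord2P i.
- under eq_fun do rewrite mxE/= /z.
  apply: is_derive_eq.
  rewrite subE mulmx_growth0 /K !mxE/= -/c1 /GRing.scale/= /z.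
  set X := expR (g * t); set Y := expR (m * t); set d := k 0 0 * b2 - _.
  transitivity (N^-1 * (y0 * X * (l * b1) - X * b1 * (theta * y0)
     + (d * Y - q * E t) * (m * b2) - b2 * q * X)); first by rewrite /g; ring.
  by rewrite -e1 e3 -cb /q /N; field.
- under eq_fun do rewrite mxE/= /z.
  apply: is_derive_eq.
  rewrite subE mulmx_growth1 /K !mxE/= -/c2 /GRing.scale/= /z.
  set X := expR (g * t); set Y := expR (m * t); set d := k 0 0 * b2 - _.
  transitivity (N^-1 * (y0 * X * (l * b2) - X * b2 * (theta * y0)
     - (d * Y - q * E t) * (m * b1) + b1 * q * X)); first by rewrite /g; ring.
  by rewrite -e2 e4 -cb /q /N; field.
Qed.

(** Along the benchmark trajectory [<K, b>] is [y0 * expR (g * t)], which stays positive. *)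
Lemma halfspace_value_benchmark :
  halfspace_value (fun=> 1) rho gamma (growth_mx A1 A2 w) b k
  = (benchmark_payoff b gamma theta y0)%:E.
Proof.
have [E [K [hK E0 _ KE]]] := benchmark_trajectory.
have b10 : 0 < b1 := bpos 0; have b20 : 0 < b2 := bpos 1.
have Mtb : (growth_mx A1 A2 w)^T *m b = l *: b by rewrite tr_growth_mx.
apply: (constrained_value_eq_benchmark bpos g0 g1 th0 y00 isT rhoE ky Mtb _ hK).
  by move=> x /=; exact: ltW.
move=> t t0 /=; have [K1 K2] := KE t.
have N0 : 0 < b1 ^+ 2 + b2 ^+ 2 by rewrite addr_gt0// exprn_gt0.
rewrite -(pmulr_rgt0 _ N0) inner2E -/b1 -/b2 mulrDr !mulrA K1 K2.
rewrite [ltRHS](_ : _ = (b1 ^+ 2 + b2 ^+ 2) * (y0 * expR (g * t))); last by ring.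
by rewrite !mulr_gt0// expR_gt0.
Qed.

Lemma orthant_halfspace x : nonneg_vec x -> 0 <= inner x b.
Proof. by move=> x0; apply: inner_ge0 => // i; exact: ltW. Qed.

(** Writing [expR (g * t)] as [(g - m) * E t + expR (m * t)] makes each coordinate of the state a
    combination of two nonnegative functions. The coefficient of [expR (m * t)] is a positive
    multiple of [k_i]; the last two hypotheses are the signs of the coefficients of [E]. *)
Lemma value_benchmark : 
  (forall i, 0 <= k i 0) -> m <= g ->
  q * b2 <= y0 * b1 * (g - m) -> - (q * b1) <= y0 * b2 * (g - m) ->
  value (fun=> 1) rho gamma (growth_mx A1 A2 w) k
  = (benchmark_payoff b gamma theta y0)%:E.
Proof.
move=> k0 mg q1 q2.
have [E [K [hK E0 EE KE]]] := benchmark_trajectory.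
have b10 : 0 < b1 := bpos 0; have b20 : 0 < b2 := bpos 1.
have Mtb : (growth_mx A1 A2 w)^T *m b = l *: b by rewrite tr_growth_mx.
apply: (constrained_value_eq_benchmark bpos g0 g1 th0 y00 isT rhoE ky Mtb
  orthant_halfspace hK).
move=> t t0 i /=; have [K1 K2] := KE t; have Et := E0 _ t0.
have N0 : 0 < b1 ^+ 2 + b2 ^+ 2 by rewrite addr_gt0// exprn_gt0.
have Y0 := expR_gt0 (m * t).
have yE : y0 = k 0 0 * b1 + k 1 0 * b2 by rewrite -ky inner2E.
rewrite -(pmulr_rge0 _ N0).
have X : expR (g * t) = (g - m) * E t + expR (m * t) by rewrite -EE subrK.
have [->|->] := ord2P i.
- rewrite K1 X [leRHS](_ : _ = (y0 * b1 * (g - m) - q * b2) * E t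
    + (b1 ^+ 2 + b2 ^+ 2) * k 0 0 * expR (m * t)); last by rewrite yE; ring.
  by rewrite addr_ge0 ?mulr_ge0 ?subr_ge0 ?k0 ?(ltW Y0) ?(ltW N0).
- rewrite K2 X [leRHS](_ : _ = (y0 * b2 * (g - m) + q * b1) * E t
    + (b1 ^+ 2 + b2 ^+ 2) * k 1 0 * expR (m * t)); last by rewrite yE; ring.
  rewrite addr_ge0 ?mulr_ge0 ?subr_ge0 ?k0 ?(ltW Y0) ?(ltW N0)//.
  by rewrite -lerBlDr sub0r.
Qed.

End two_nodes.

(** * Strong links, weak links and the shape of the eigenvector *)

Section two_node_cases.
Variables (R : realType) (A1 A2 w l gamma theta rho y0 : R) (b k : 'cV[R]_2).
Hypotheses (bpos : pos_vec b) (g0 : 0 < gamma) (g1 : gamma != 1).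
Hypotheses (th0 : 0 < theta) (kpos : pos_vec k) (w0 : 0 < w).
Hypotheses (Mb : growth_mx A1 A2 w *m b = l *: b) (ky : inner k b = y0).
Hypothesis rhoE : gamma * theta = rho - l * (1 - gamma).
Hypothesis A12 : A1 <= A2.

Let b1 := b 0 0.
Let b2 := b 1 0.
Let b10 : 0 < b1. Proof. exact: bpos. Qed.
Let b20 : 0 < b2. Proof. exact: bpos. Qed.
Let yE : y0 = k 0 0 * b1 + k 1 0 * b2. Proof. by rewrite -ky inner2E. Qed.
Let y00 : 0 < y0.
Proof. by rewrite yE addr_gt0// mulr_gt0//; exact: kpos. Qed.

(** The sum of the two eigenvector equations is [(l - A1) * b1 = (A2 - l) * b2], so [l - A1] and
    [A2 - l] have the same sign. *)
Lemma eigen_bounds : A1 <= l <= A2.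
Proof.
move: (eigen_eq0 Mb) (eigen_eq1 Mb); rewrite -/b1 -/b2 => e1 e2.
have e : (l - A1) * b1 = (A2 - l) * b2 by lra.
apply/andP; split; rewrite leNgt; apply/negP => h.
- have : (l - A1) * b1 < 0 by rewrite pmulr_llt0// subr_lt0.
  rewrite e; apply/negP; rewrite -leNgt mulr_ge0 ?subr_ge0 ?(ltW b20)//.
  by rewrite ltW// (lt_le_trans h).
- have : (A2 - l) * b2 < 0 by rewrite pmulr_llt0// subr_lt0.
  rewrite -e; apply/negP; rewrite -leNgt mulr_ge0 ?subr_ge0 ?(ltW b10)//.
  by rewrite ltW// (le_lt_trans _ h).
Qed.

Let c_gt0 i : 0 < benchmark_coef b gamma theta y0 i.
Proof. exact: benchmark_coef_gt0. Qed.

(** [l - theta] equals [(l - rho) / gamma], which increases with [l]; this gives a bound independent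
    of [w]. *)
Lemma benchmark_rate_ge : (A1 - rho) / gamma <= l - theta.
Proof.
have /andP[lA1 _] := eigen_bounds.
have -> : l - theta = (l - rho) / gamma.
  have -> : theta = (rho - l * (1 - gamma)) / gamma by rewrite -rhoE mulrC mulKf ?gt_eqF.
  by field; rewrite gt_eqF.
by rewrite ler_pM2r ?invr_gt0// lerD2r.
Qed.

(** For large [w] the entries of [b] are comparable, [b1 <= b2 <= 2 * b1], so both products in [q]
    are at most [2 * (D * y0)], while the spectral gap [g - m] is at least [4 * D] and dominates
    them. *)
Lemma value_benchmark_strong_link (D : R) :
  A2 - (A1 - rho) / gamma <= D -> A2 - A1 <= w -> 5 * D <= 2 * w ->
  value (fun=> 1) rho gamma (growth_mx A1 A2 w) k
  = (benchmark_payoff b gamma theta y0)%:E.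
Proof.
move=> hD hA hw; have /andP[lA1 lA2] := eigen_bounds.
have gA := benchmark_rate_ge.
have cb := sum_benchmark_coef gamma theta y0 bpos isT; rewrite sum_ord2 in cb.
move: (eigen_eq0 Mb) (eigen_eq1 Mb) cb (c_gt0 0) (c_gt0 1); rewrite -/b1 -/b2.
set c1 := benchmark_coef _ _ _ _ 0; set c2 := benchmark_coef _ _ _ _ 1.
move=> e1 e2 cb c10 c20.
have b12 : b2 <= 2 * b1.
  rewrite -(ler_pM2l w0); have : (l - A1) * b1 <= w * b1 by rewrite ler_pM2r//; lra.
  lra.
have b21 : b1 <= b2.
  rewrite -(ler_pM2l w0); have : (l - A2) * b2 <= 0 by rewrite pmulr_lle0// subr_le0.
  lra.
(* Of the [5 * D] provided by [2 * w], one [D] pays for the lower bound [A2 - D] of the growth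
   rate. *)
have gm : 4 * D <= l - theta - (A1 + A2 - 2 * w - l) by lra.
have thD : theta <= D by lra.
have cb2 : 0 < c2 * b2 by rewrite mulr_gt0.
have cb1 : 0 < c1 * b1 by rewrite mulr_gt0.
have thy : theta * y0 <= D * y0 by rewrite ler_pM2r.
have Dy : 4 * (D * y0) <= y0 * (l - theta - (A1 + A2 - 2 * w - l)).
  by rewrite mulrA [leRHS]mulrC ler_pM2r.
have q1 : c1 * b2 <= 2 * (D * y0).
  have : c1 * b2 <= c1 * (2 * b1) by rewrite ler_pM2l.
  lra.
have q2 : c2 * b1 <= D * y0.
  have : c2 * b1 <= c2 * b2 by rewrite ler_pM2l.
  lra.
have p1 : 0 < c1 * b2 by rewrite mulr_gt0.
have p2 : 0 < c2 * b1 by rewrite mulr_gt0.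
apply: (value_benchmark bpos g0 g1 th0 y00 Mb ky rhoE).
- by move=> i; exact: ltW.
- lra.
- rewrite -/b1 -/b2 -/c1 -/c2 [leRHS]mulrAC.
  set G := y0 * _ in Dy *.
  apply: (@le_trans _ _ (2 * (D * y0) * b2)); first by rewrite ler_pM2r//; lra.
  apply: (@le_trans _ _ (2 * (D * y0) * (2 * b1))); first by rewrite ler_pM2l//; lra.
  by rewrite mulrA ler_pM2r//; lra.
- rewrite -/b1 -/b2 -/c1 -/c2 [leRHS]mulrAC -mulNr.
  set G := y0 * _ in Dy *.
  apply: (@le_trans _ _ ((D * y0) * b1)); first by rewrite ler_pM2r//; lra.
  apply: (@le_trans _ _ ((D * y0) * b2)); first by rewrite ler_pM2l//; lra.
  by rewrite ler_pM2r//; lra.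
Qed.


(** The violated inequality concerns total consumption on [[0, 1]]: aggregate capital grows at a
    rate at most [A2] in the orthant, so total consumption discounted at [A2] is at most
    [k 0 0 + k 1 0], less than what the benchmark consumes at node [0] alone. *)
Lemma value_lt_benchmark_weak_link (D : R) :
  A2 - (A1 - rho) / gamma <= D ->
  k 0 0 + k 1 0 < benchmark_coef b gamma theta y0 0 * expR (- D) ->
  (value (fun=> 1%R) rho gamma (growth_mx A1 A2 w) k
  < (benchmark_payoff b gamma theta y0)%:E)%E.
Proof.
move=> hD hc; have /andP[lA1 lA2] := eigen_bounds.
have gA := benchmark_rate_ge.
have k0 i : 0 < k i 0 by exact: kpos.
have Mtb : (growth_mx A1 A2 w)^T *m b = l *: b by rewrite tr_growth_mx.
have expD (s : R) : 0 <= s <= 1 -> - D <= - A2 * s + (l - theta) * s.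
  move=> /andP[s0 s1]; have gA2 : 0 <= A2 - (l - theta).
    by have := th0; lra.
  have : (A2 - (l - theta)) * s <= (A2 - (l - theta)) * 1 by rewrite ler_wpM2l.
  lra.
pose u : 'cV[R]_2 := const_mx 1.
have u0 : nonneg_vec u by move=> i; rewrite mxE.
pose phi (t : R) : 'cV[R]_2 := expR (- A2 * t) *: u.
have phiE t i : phi t i 0 = expR (- A2 * t) by rewrite !mxE mulr1.
have innerphi x t : inner x (phi t) = expR (- A2 * t) * inner x u.
  by rewrite innerC innerZl innerC.
(* [b1^-1 + b2^-1] times either entry of [b] is at least 1, and [l <= A2] compares the
   exponentials. *)
apply: (@constrained_value_lt_benchmark _ _ _ l _ _ _ bpos g0 g1 th0 y00 isT rho
  _ _ rhoE ky Mtb _ (orthant_halfspace bpos) phi 1 (b1^-1 + b2^-1) (k 0 0 + k 1 0)).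
- by rewrite addr_gt0 ?invr_gt0.
- by rewrite addr_ge0 ?ltW.
- by move=> i; under eq_fun do rewrite phiE; exact: continuous_expRM.
- move=> t i /andP[t0 _]; rewrite phiE expR_ge0 /= mulrA.
  apply: (@le_trans _ _ (1 * expR (- (l * t)))).
    by rewrite mul1r ler_expR mulNr lerN2 ler_wpM2r.
  rewrite ler_pM2r ?expR_gt0//.
  have [->|->] := ord2P i.
  + by rewrite -/b1 mulrDl mulVf ?gt_eqF// lerDl mulr_ge0 ?invr_ge0 ?ltW.
  + by rewrite -/b2 mulrDl [leRHS]addrC mulVf ?gt_eqF// lerDl mulr_ge0 ?invr_ge0 ?ltW.
- move=> C K hC hK K0; under eq_Rintegral do rewrite innerphi.
  rewrite (discounted_consumption hC hK u _ ler01).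
  have -> : inner k u = k 0 0 + k 1 0 by rewrite inner2E !mxE !mulr1.
  have uK : 0 <= expR (- A2 * 1) * inner (K 1) u.
    by rewrite mulr_ge0 ?expR_ge0// inner_ge0//; exact: K0.
  (* The vector [M^T u - A2 u] has entries [A1 - A2] and 0, so its pairing with a nonnegative state
     is nonpositive. *)
  suff : \int[mu]_(s in `[0, 1]) (expR (- A2 * s) *
      inner (K s) ((growth_mx A1 A2 w)^T *m u + - A2 *: u)) <= 0 by lra.
  rewrite -[leRHS](mul0r (fine (mu (`[0, 1] : set R)))) -Rintegral_cst//.
  apply: le_Rintegral => //.
  + apply: integrable_continuousM; first exact: continuous_expRM.
    by apply: continuous_integrable_itv; exact: (inner_state_continuous hK).
  + by apply: continuous_integrable_itv; apply: continuous_subspaceT; exact: cst_continuous.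
  + move=> s; rewrite /= in_itv/= => /andP[s0 _].
    rewrite pmulr_rle0 ?expR_gt0// inner2E tr_growth_mx.
    rewrite mxE mulmx_growth0 [X in _ + K s 1 0 * X]mxE mulmx_growth1 !mxE.
    have : K s 0 0 * (A1 - A2) <= 0 by rewrite mulr_ge0_le0 ?subr_le0 ?(K0 _ s0).
    lra.
- apply: (lt_le_trans hc).
  have hcst : benchmark_coef b gamma theta y0 0 * expR (- D) =
      \int[mu]_(t in `[0, 1]) (benchmark_coef b gamma theta y0 0 * expR (- D)).
    by rewrite Rintegral_cst//= lebesgue_measure_itv/= lte_fin ltr01 oppr0 adde0 mulr1.
  rewrite hcst; apply: le_Rintegral => //.
  + by apply: continuous_integrable_itv; apply: continuous_subspaceT; exact: cst_continuous.
  + rewrite (_ : EFin \o _ = EFin \o (fun t => expR (- A2 * t) *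
        inner (benchmark_control b l gamma theta y0 t) u)); last first.
      by apply/funext => t /=; rewrite innerphi.
    apply: integrable_continuousM; first exact: continuous_expRM.
    by apply: inner_control_integrable; exact: control_benchmark.
  + move=> t; rewrite /= in_itv/= => /andP[t0 t1].
    rewrite innerphi inner2E !mxE !mulr1 -mulrDl.
    rewrite mulrCA -expRD; apply: ler_pM; rewrite ?expR_ge0 ?(ltW (c_gt0 _))//.
      by rewrite lerDl ltW.
    by rewrite ler_expR expD// t0.
Qed.

(** The right-hand side equals [theta * y0 / b2], and [y0 >= k 1 0 * b2]. Hence the consumption at
    node [0] blows up when [b1 / b2] tends to 0. *)
Lemma benchmark_coef_lower_bound :
  theta * k 1 0 <= benchmark_coef b gamma theta y0 0
    * (b1 / b2 + (b1 / b2) `^ (gamma^-1)).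
Proof.
rewrite /benchmark_coef /benchmark_scale sum_ord2 -/b1 -/b2.
set B := _ + _.
have B0 : 0 < B by rewrite addr_gt0// powR_gt0.
have hb : b1 `^ (- gamma^-1) * (b1 / b2 + (b1 / b2) `^ gamma^-1) = B / b2.
  have -> : (b1 / b2) `^ gamma^-1 = b1 `^ gamma^-1 / b2 `^ gamma^-1.
    rewrite powRM ?invr_ge0 ?ltW// -(powR_inv1 (ltW b20)) -powRrM mulN1r.
    by rewrite powRN.
  have pD x : 0 < x -> x `^ (1 - gamma^-1) = x / x `^ gamma^-1.
    by move=> x0; rewrite powRB ?(gt_eqF x0) ?implybT// powRr1// ltW.
  rewrite /B !pD// powRN; field.
  by rewrite !gt_eqF ?powR_gt0.
rewrite -mulrA hb.
have -> : theta * y0 / B * (B / b2) = theta * (y0 / b2) by field; rewrite !gt_eqF.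
rewrite ler_pM2l// ler_pdivlMr// yE lerDr mulr_ge0 ?ltW//; exact: kpos.
Qed.

(** When [A1 < A2], a weak link concentrates [b] on node [1]: the ratio is of order [w]. The second
    eigenvector equation gives [A2 - l <= w], and the first then bounds [(A2 - A1) * b1] by
    [w * b2]. *)
Lemma eigenvector_ratio_le : b1 / b2 * (A2 - A1) <= w.
Proof.
move: (eigen_eq0 Mb) (eigen_eq1 Mb); rewrite -/b1 -/b2 => h1 h2.
have h : A2 - l <= w.
  rewrite -(ler_pM2r b20); have : 0 < w * b1 by rewrite mulr_gt0.
  lra.
have : (A2 - l) * b1 <= w * b1 by rewrite ler_pM2r.
rewrite mulrAC ler_pdivrMr//; lra.
Qed.

(** * Equal productivities *)

Hypothesis A12E : A1 = A2.

Lemma equal_eigenvalue : l = A1.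
Proof. by have := eigen_bounds; rewrite -A12E => /le_anti. Qed.

Lemma equal_eigenvector : b1 = b2.
Proof.
have := eigen_eq0 Mb; rewrite equal_eigenvalue -/b1 -/b2 => h.
have : w * (b2 - b1) = (A1 - w) * b1 + w * b2 - A1 * b1 by ring.
by rewrite h subrr => /eqP; rewrite mulf_eq0 gt_eqF//= subr_eq0 => /eqP.
Qed.

(** Here [b1 = b2], so [q = 0] and the sign conditions reduce to [m <= g]. *)
Lemma value_benchmark_equal : A1 - 2 * w <= l - theta ->
  value (fun=> 1) rho gamma (growth_mx A1 A2 w) k
  = (benchmark_payoff b gamma theta y0)%:E.
Proof.
move=> h; have hl := equal_eigenvalue; have bE := equal_eigenvector.
have q0 : benchmark_coef b gamma theta y0 0 * b2 - benchmark_coef b gamma theta y0 1 * b1 = 0.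
  by rewrite /benchmark_coef -/b1 -/b2 bE subrr.
have gm : 0 <= l - theta - (A1 + A2 - 2 * w - l).
  by have e := A12E; lra.
apply: (value_benchmark bpos g0 g1 th0 y00 Mb ky rhoE).
- by move=> i; exact: ltW.
- by rewrite -subr_ge0.
- by rewrite -/b1 -/b2 q0 mul0r mulr_ge0// mulr_ge0// ltW.
- by rewrite -/b1 -/b2 q0 mul0r oppr0 mulr_ge0// mulr_ge0// ltW.
Qed.

(* The functional encodes [K_i (T) >= 0] for the node [i] with the smaller
   initial endowment, which the benchmark trajectory violates for large [T]. *)
Lemma value_lt_benchmark_equal : k 0 0 != k 1 0 -> l - theta < A1 - 2 * w ->
  (value (fun=> 1%R) rho gamma (growth_mx A1 A2 w) k
  < (benchmark_payoff b gamma theta y0)%:E)%E.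
Proof.
move=> k01 h; have hl := equal_eigenvalue; have bE := equal_eigenvector.
set m := A1 - 2 * w in h.
have k0 i : 0 < k i 0 by exact: kpos.
have Mtb : (growth_mx A1 A2 w)^T *m b = l *: b by rewrite tr_growth_mx.
(* The sign makes [d] the absolute difference of the endowments, and [u - v] below twice the basis
   vector of the poorer node. *)
pose sg : R := if k 1 0 < k 0 0 then 1 else -1.
pose d := sg * (k 0 0 - k 1 0).
pose s := k 0 0 + k 1 0.
have d0 : 0 < d.
  rewrite /d /sg; case: (ltP (k 1 0) (k 0 0)) => h01; first by rewrite mul1r subr_gt0.
  by rewrite mulN1r opprB subr_gt0 lt_neqAle k01.
have sg1 : sg = 1 \/ sg = -1 by rewrite /sg; case: ifP; [left|right].
have ds : d <= s.
  have := k0 0; have := k0 1; rewrite /d /s.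
  by case: sg1 => ->; lra.
have s0 : 0 < s by rewrite addr_gt0.
pose u : 'cV[R]_2 := const_mx 1.
pose v : 'cV[R]_2 := \col_i if i == 0 then sg else - sg.
have Mu : (growth_mx A1 A2 w)^T *m u = A1 *: u.
  apply/matrixP => i j; rewrite ord1 tr_growth_mx.
  have [->|->] := ord2P i; rewrite ?mulmx_growth0 ?mulmx_growth1 !mxE -?A12E; ring.
have Mv : (growth_mx A1 A2 w)^T *m v = m *: v.
  apply/matrixP => i j; rewrite ord1 tr_growth_mx.
  have [->|->] := ord2P i; rewrite ?mulmx_growth0 ?mulmx_growth1 !mxE -?A12E /m/=; ring.
have [T [T0 sdT]] : exists T : R, 0 <= T /\ s * expR ((l - theta) * T) < d * expR (m * T).
  have e0 : 0 < m - (l - theta) by rewrite subr_gt0.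
  (* For this [T] the exponents differ by [s / d], and [d * (1 + s / d)] already exceeds [s]. *)
  exists (s / d / (m - (l - theta))); split; first by rewrite !divr_ge0// ltW.
  set T := s / d / _.
  have -> : m * T = (m - (l - theta)) * T + (l - theta) * T by rewrite -mulrDl subrK.
  rewrite expRD mulrA ltr_pM2r ?expR_gt0//.
  apply: (@lt_le_trans _ _ (d * (1 + (m - (l - theta)) * T))).
    by rewrite mulrDr mulr1 /T [X in d * X]mulrC divfK ?gt_eqF// mulrC divfK ?gt_eqF// ltrDr.
  by rewrite ler_pM2l// expR_ge1Dx.
have mA : m <= A1 by have := w0; rewrite /m; lra.
(* Variation of constants: [<C, phi>] integrates to [Q] minus the pairing of [K T] with [u - v], so
   nonnegativity of the poorer node at time [T] reads as a bound by [Q]. *)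
pose phi (t : R) : 'cV[R]_2 := expR (A1 * (T - t)) *: u - expR (m * (T - t)) *: v.
pose Q := expR (A1 * T) * s - expR (m * T) * d.
have phiE t i : phi t i 0 = expR (A1 * (T - t)) - expR (m * (T - t)) * v i 0.
  by rewrite !mxE mulr1.
have identity C K : control C -> state_trajectory (growth_mx A1 A2 w) k C K ->
    \int[mu]_(t in `[0, T]) inner (C t) (phi t) = Q - (inner (K T) u - inner (K T) v).
  move=> hC hK.
  have hu := discounted_consumption_eigen hC hK Mu T0.
  have hv := discounted_consumption_eigen hC hK Mv T0.
  have iexp a x : mu.-integrable `[0, T] (EFin \o (fun t => expR (- a * t) * inner (C t) x)).
    apply: integrable_continuousM; first exact: continuous_expRM.
    exact: inner_control_integrable.
  have -> : \int[mu]_(t in `[0, T]) inner (C t) (phi t) =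
      \int[mu]_(t in `[0, T]) (expR (A1 * T) * (expR (- A1 * t) * inner (C t) u)
        - expR (m * T) * (expR (- m * t) * inner (C t) v)).
    apply: eq_Rintegral => t _.
    rewrite innerC innerBl !innerZl innerC (innerC v) !mulrA -!expRD.
    by congr (expR _ * _ - expR _ * _); ring.
  rewrite RintegralB//; [|exact: (integrableZl _ _ (iexp A1 u))|exact: (integrableZl _ _ (iexp m v))].
  rewrite !RintegralZl// hu hv !mulrBr !mulrA -!expRD.
  rewrite !mulNr !subrr expR0 !mul1r.
  have -> : inner k u = s by rewrite inner2E !mxE !mulr1.
  have -> : inner k v = d by rewrite inner2E !mxE /d/=; ring.
  by rewrite /Q; ring.
have [E [K [hK _ _ KE]]] := benchmark_trajectory gamma theta bpos Mb ky.
(* As [l = A1] and [b1 = b2], the constant times [b_i exp (- l t)] is [2 * expR (A1 * (T - t))],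
   which dominates [phi] because the entries of [v] are 1 and -1 and [m <= A1]. *)
apply: (@constrained_value_lt_benchmark _ _ _ l _ _ _ bpos g0 g1 th0 y00 isT rho
  _ _ rhoE ky Mtb _ (orthant_halfspace bpos) phi T (2 * expR (A1 * T) / b1) Q).
- by rewrite !mulr_gt0 ?expR_gt0 ?invr_gt0.
- by rewrite subr_ge0 ler_pM ?expR_ge0 ?ler_expR ?ler_wpM2r// ltW.
- move=> i; under eq_fun do rewrite phiE.
  have cexp a : continuous (fun t => expR (a * (T - t))).
    move=> t; apply: continuous_comp; last exact: continuous_expR.
    apply: cvgMl_tmp; apply: cvgB; [exact: cvg_cst | exact: cvg_id].
  by move=> t; apply: cvgB; [exact: cexp | apply: cvgMr_tmp; exact: cexp].
- move=> t i /andP[t0 tT]; rewrite phiE.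
  have v1 : -1 <= v i 0 <= 1.
    by rewrite mxE; case: sg1 => ->; case: ifP => _; apply/andP; split; lra.
  have em : expR (m * (T - t)) <= expR (A1 * (T - t)).
    by rewrite ler_expR ler_wpM2r// subr_ge0.
  have ep := expR_gt0 (m * (T - t)).
  have /andP[v1l v1r] := v1.
  have h1 : expR (m * (T - t)) * v i 0 <= expR (m * (T - t)) * 1 by rewrite ler_pM2l.
  have h2 : expR (m * (T - t)) * -1 <= expR (m * (T - t)) * v i 0 by rewrite ler_pM2l.
  rewrite (_ : b i 0 = b1); last by have [->|->] := ord2P i.
  rewrite mulrA divfK ?gt_eqF// -mulrA -expRD.
  rewrite (_ : A1 * T + - (l * t) = A1 * (T - t)); last by rewrite hl; ring.
  by apply/andP; split; lra.
- move=> C K' hC hK' K0; rewrite (identity C K')// gerBl.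
  have K00 := K0 _ T0 0; have K01 := K0 _ T0 1.
  rewrite !inner2E !mxE/=; case: sg1 => ->; lra.
- rewrite (identity _ K)//; last exact: control_benchmark.
  (* What remains is that the pairing of [K T] with [u], equal to [s * X], is below its pairing with
     [v], equal to [d * Y]: this is the choice of [T]. *)
  rewrite ltrBrDr gtrDl subr_lt0.
  have mE : A1 + A2 - 2 * w - l = m by rewrite -A12E hl /m; ring.
  have [] := KE T; rewrite mE -/b1 -/b2 -bE.
  have -> : benchmark_coef b gamma theta y0 0 * b1 - benchmark_coef b gamma theta y0 1 * b1 = 0.
    by rewrite /benchmark_coef -/b1 -/b2 -bE subrr.
  have yb : y0 = s * b1 by rewrite yE -bE /s; ring.
  rewrite yb mul0r subr0; set X := expR ((l - theta) * T) in sdT *; set Y := expR (m * T) in sdT *.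
  have N0 : 2 * b1 ^+ 2 != 0 by rewrite gt_eqF// mulr_gt0// exprn_gt0.
  move=> K1 K2.
  have {}K1 : 2 * K T 0 0 = s * X + (k 0 0 - k 1 0) * Y.
    apply: (mulfI N0); transitivity (2 * ((b1 ^+ 2 + b1 ^+ 2) * K T 0 0)); first by ring.
    by rewrite K1; ring.
  have {}K2 : 2 * K T 1 0 = s * X - (k 0 0 - k 1 0) * Y.
    apply: (mulfI N0); transitivity (2 * ((b1 ^+ 2 + b1 ^+ 2) * K T 1 0)); first by ring.
    by rewrite K2; ring.
  rewrite !inner2E !mxE/= /d in sdT *.
  have e1 : K T 0 0 + K T 1 0 = s * X by lra.
  have e2 : K T 0 0 - K T 1 0 = (k 0 0 - k 1 0) * Y by lra.
  rewrite !mulr1 e1 mulrN -mulNr [K T 0 0 * _]mulrC.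
  rewrite (_ : _ * K T 0 0 + _ = sg * (K T 0 0 - K T 1 0)); last by ring.
  by rewrite e2 mulrA.
Qed.

End two_node_cases.

(** * Uniform bounds and thresholds for the link weight *)

(** The right-hand side is monotone in [l], in a direction given by the sign of [1 - gamma]; the two
    terms of the minimum serve the two signs. It bounds [theta] from below uniformly in [w]. *)
Lemma discount_lower_bound (R : realType) (A l rho gamma : R) :
  0 < l -> l <= A ->
  Num.min rho (rho - A * (1 - gamma)) <= rho - l * (1 - gamma).
Proof.
move=> l0 lA; rewrite ge_min; have [h|h] := leP 1 gamma; apply/orP.
- by left; rewrite lerDl oppr_ge0 pmulr_rle0// subr_le0.
- by right; rewrite lerD2l lerN2 ler_wpM2r// subr_ge0 ltW.
Qed.

(* In (i), the implication from V = V_b0 to the bound on w is restricted to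
   k_1 <> k_2: it fails on the diagonal, where V = V_b0 for every w > 0. *)
Theorem proposition5p14 (R : realType) (A1 A2 rho gamma : R) (k : 'cV[R]_2)
    (hA1 : 0 < A1) (hA12 : A1 <= A2) (hrho : 0 < rho)
    (hgamma : 0 < gamma) (hgamma1 : gamma != 1)
    (hrhoA : A2 * (1 - gamma) < rho) (hk : pos_vec k) :
  let p := fun _ : 'I_2 => 1 in
  let V := fun w : R => value p rho gamma (growth_mx A1 A2 w) k in
  let Vb := fun (w : R) (b : 'cV[R]_2) => halfspace_value p rho gamma (growth_mx A1 A2 w) b k in
  let is_b0 := fun (w : R) (b : 'cV[R]_2) => positive_top_eigenvector (growth_mx A1 A2 w) b in
  (A1 = A2 ->
     forall (w : R) (b0 : 'cV[R]_2), 0 < w -> is_b0 w b0 ->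
       (k 0 0 != k 1 0 ->
          (V w = Vb w b0 <-> (rho - A1 * (1 - gamma)) / (2 * gamma) <= w)) /\
       ((rho - A1 * (1 - gamma)) / (2 * gamma) <= w -> V w = Vb w b0))
  /\
  (A1 < A2 ->
     exists wu wl : R,
       [/\ wl < wu, 0 < wl,
           forall (w : R) (b0 : 'cV[R]_2), wu <= w -> is_b0 w b0 -> V w = Vb w b0
         & forall (w : R) (b0 : 'cV[R]_2), 0 < w < wl -> is_b0 w b0 -> V w <> Vb w b0]).
Proof.
move=> p V Vb is_b0.
pose th0 := Num.min rho (rho - A2 * (1 - gamma)) / gamma.
have th00 : 0 < th0 by rewrite divr_gt0// lt_min hrho subr_gt0.
have prelim w b : 0 < w -> is_b0 w b -> exists l th : R,
    [/\ growth_mx A1 A2 w *m b = l *: b, A1 <= l <= A2,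
      gamma * th = rho - l * (1 - gamma), th0 <= th &
      Vb w b = (benchmark_payoff b gamma th (inner k b))%:E].
  move=> w0 [bpos [l _ Mb]]; exists l, ((rho - l * (1 - gamma)) / gamma).
  have /andP[lA1 lA2] := eigen_bounds bpos Mb hA12.
  have thE : gamma * ((rho - l * (1 - gamma)) / gamma) = rho - l * (1 - gamma).
    by rewrite mulrC divfK// gt_eqF.
  have hth : th0 <= (rho - l * (1 - gamma)) / gamma.
    by rewrite ler_pM2r ?invr_gt0// discount_lower_bound// (lt_le_trans hA1).
  split=> //; first by rewrite lA1.
  apply: (halfspace_value_benchmark bpos hgamma hgamma1 _ _ Mb erefl thE).
    exact: lt_le_trans hth.
  by rewrite inner2E addr_gt0// mulr_gt0.
split.
- move=> A12 w b w0 hb; have [l [th [Mb lb thE hth VbE]]] := prelim w b w0 hb.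
  have bpos := hb.1; have th_gt0 := lt_le_trans th00 hth.
  have lE : l = A1 by move: lb; rewrite -A12 => /le_anti.
  (* The threshold is [th / 2], and [th <= 2 * w] says that the second eigenvalue [A1 - 2 * w] does
     not exceed the growth rate [A1 - th]. *)
  have iffw : ((rho - A1 * (1 - gamma)) / (2 * gamma) <= w) = (A1 - 2 * w <= l - th).
    rewrite lE in thE *; rewrite -thE ler_pdivrMr ?mulr_gt0// lerD2l lerN2.
    by rewrite (_ : w * (2 * gamma) = gamma * (2 * w)) ?ler_pM2l//; ring.
  have sat : (rho - A1 * (1 - gamma)) / (2 * gamma) <= w -> V w = Vb w b.
    rewrite iffw VbE => h.
    exact: (value_benchmark_equal bpos hgamma hgamma1 th_gt0 hk w0 Mb erefl thE hA12 A12 h).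
  split=> // k01; split=> //; rewrite iffw leNgt => VV; apply/negP => h.
  have lt : (V w < Vb w b)%E.
    rewrite VbE.
    exact: (value_lt_benchmark_equal bpos hgamma hgamma1 th_gt0 hk w0 Mb erefl thE hA12 A12 k01 h).
  by rewrite VV ltxx in lt.
- move=> A12.
  pose D := A2 - (A1 - rho) / gamma.
  have D0 : 0 < D by rewrite /D subr_gt0 ltr_pdivrMr//; lra.
  have A0 : 0 < A2 - A1 by rewrite subr_gt0.
  have k0 i : 0 < k i 0 by exact: hk.
  pose e := th0 * k 1 0 * expR (- D) / (k 0 0 + k 1 0).
  have e0 : 0 < e.
    by apply: divr_gt0; [exact: mulr_gt0 (mulr_gt0 th00 (k0 1)) (expR_gt0 _) | exact: addr_gt0].
  pose x := Num.min (e / 2) ((e / 2) `^ gamma).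
  have x0 : 0 < x by rewrite lt_min divr_gt0// powR_gt0// divr_gt0.
  (* The upper threshold secures both [A2 - A1 <= w] and [5 * D <= 2 * w]. Below [(A2 - A1) * x] the
     eigenvector ratio is less than [x], and the minimum with [A2 - A1] keeps the thresholds
     ordered. *)
  exists ((A2 - A1) + 5 * D), (Num.min (A2 - A1) ((A2 - A1) * x)); split.
  + by rewrite gt_min ltrDl mulr_gt0.
  + by rewrite lt_min A0 mulr_gt0.
  + move=> w b hw hb.
    have w0 : 0 < w by rewrite (lt_le_trans _ hw)// addr_gt0// mulr_gt0.
    have [l [th [Mb lb thE hth VbE]]] := prelim w b w0 hb.
    rewrite VbE; apply: (@value_benchmark_strong_link _ _ _ _ l _ _ _ _ _ _ hb.1 _ _
       (lt_le_trans th00 hth) hk w0 Mb erefl thE hA12 D) => //; lra.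
  + move=> w b /andP[w0]; rewrite lt_min => /andP[_ hw] hb.
    have [l [th [Mb lb thE hth VbE]]] := prelim w b w0 hb.
    have bpos := hb.1; have th_gt0 := lt_le_trans th00 hth.
    have y0 : 0 < inner k b by rewrite inner2E addr_gt0// mulr_gt0.
    have c0 := benchmark_coef_gt0 gamma bpos th_gt0 y0 isT 0.
    have := benchmark_coef_lower_bound gamma bpos th_gt0 hk erefl.
    set c := benchmark_coef _ _ _ _ 0 in c0 *; set r := b 0 0 / b 1 0 => hc.
    have r0 : 0 < r by rewrite divr_gt0.
    have rx : r < x.
      rewrite -(ltr_pM2r A0) [ltRHS]mulrC; apply: le_lt_trans hw.
      exact: eigenvector_ratio_le bpos w0 Mb.
    have /andP[r1 r2] : (r < e / 2) && (r < (e / 2) `^ gamma) by rewrite -lt_min.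
    have e20 : 0 < e / 2 by rewrite divr_gt0.
    have r3 : r `^ gamma^-1 < e / 2.
      have eE : ((e / 2) `^ gamma) `^ gamma^-1 = e / 2.
        by rewrite -powRrM mulfV ?powRr1 ?(ltW e20)// gt_eqF.
      rewrite -{}eE; move: r2; set f := _ `^ gamma => r2.
      have f0 : f \is Num.nneg by rewrite nnegrE powR_ge0.
      have r0' : r \is Num.nneg by rewrite nnegrE ltW.
      have i0 : 0 < gamma^-1 by rewrite invr_gt0.
      exact: (gt0_ltr_powR i0 r0' f0 r2).
    have re : c * (r + r `^ gamma^-1) < c * e by rewrite ltr_pM2l//; lra.
    have th1 : th0 * k 1 0 <= th * k 1 0 by rewrite ler_pM2r.
    have lt : (V w < Vb w b)%E.
      rewrite VbE; apply: (value_lt_benchmark_weak_link bpos hgamma hgamma1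
        th_gt0 hk Mb erefl thE hA12 (lexx D)).
      have := le_lt_trans (le_trans th1 hc) re.
      have -> : c * e = th0 * k 1 0 * (c * expR (- D)) / (k 0 0 + k 1 0).
        by rewrite /e; ring.
      by rewrite ltr_pdivlMr ?addr_gt0// ltr_pM2l// mulr_gt0.
    by move=> VV; rewrite VV ltxx in lt.
Qed.
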